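(* Let $A$ be a piecewise hereditary algebra and $\phi$ an automorphism of $\hat{A}$ with jump $0\neq n\in\mathbb{Z}$. Then $\hat{A}/\langle\phi\rangle$ and $T^n_{\phi_0}(A)$ are isomorphic as $\mathbb{Z}$-graded categories.
   Context: Conventions. $\Bbbk$ is an algebraically closed field, $D=\operatorname{Hom}_{\Bbbk}(-,\Bbbk)$; all categories and functors are $\Bbbk$-linear. All algebras are basic, connected, nonzero, finite-dimensional $\Bbbk$-algebras. An algebra $A$ is identified with the category with object set $A_0$, a fixed complete set of orthogonal primitive idempotents of $A$, with $A(x,y)=yAx$ and composition given by multiplication. Automorphisms of a category are ($\Bbbk$-linear) isomorphisms of the category onto itself. $A$ is piecewise hereditary if it is derived equivalent to a hereditary algebra. Repetitive category $\hat{A}$. Objects: $x^{[i]}:=(x,i)$ with $x\in A_0$, $i\in\mathbb{Z}$. Morphisms: $\hat{A}(x^{[i]},y^{[i]})=\{f^{[i]}\mid f\in A(x,y)\}$, $\hat{A}(x^{[i]},y^{[i+1]})=\{\beta^{[i]}\mid\beta\in D(A(y,x))\}$, all other morphism spaces zero. Composition is that of $A$, or the $A$-bimodule structure of $DA$ ($(\beta f)(u)=\beta(fu)$, $(f\beta)(u)=\beta(uf)$), and zero for two morphisms both raising the index. The Nakayama automorphism $\nu_A$ of $\hat{A}$ raises all indices $[i]$ to $[i+1]$. $A^{[i]}$ is the full subcategory on the objects $x^{[i]}$ $(x\in A_0)$, and $\mathrm{id}^{[i]}\colon A\to A^{[i]}$ is the isomorphism $x\mapsto x^{[i]}$, $f\mapsto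 f^{[i]}$. An automorphism $\phi$ of $\hat{A}$ has jump $n$ if $\phi(A^{[0]})=A^{[n]}$. For $\phi$ with jump $n$, $\phi_0:=(\mathrm{id}^{[0]})^{-1}\phi\,\nu_A^{-n}\,\mathrm{id}^{[0]}$, an automorphism of $A$. For an automorphism $\sigma$ of $A$, $\hat{\sigma}$ is the automorphism of $\hat{A}$ with $\hat\sigma(x^{[i]})=(\sigma x)^{[i]}$, $\hat\sigma(f^{[i]})=(\sigma f)^{[i]}$ and $\hat\sigma(\beta^{[i]})=(\beta\circ(\sigma|_{A(y,x)})^{-1})^{[i]}$ for $\beta\in D(A(y,x))$. The twisted $n$-fold extension is $T^n_{\sigma}(A):=\hat{A}/\langle\hat{\sigma}\nu_A^n\rangle$. Orbit categories. For an automorphism $g$ of $\hat{A}$ with jump $n\ne 0$, the action $k\mapsto g^k$ of $\mathbb{Z}$ on $\hat{A}$ is free and $\hat{A}/\langle g\rangle$ is the classical orbit category: its objects are the $\langle g\rangle$-orbits of objects; choosing orbit representatives, the morphism space from the orbit of $x$ to that of $y$ is $\bigoplus_{k\in\mathbb{Z}}\hat{A}(g^kx,y)$ ($x,y$ the representatives), with composition $(q_l)_l\cdot(f_k)_k=\big(\sum_{l+k=m}q_l\,g^l(f_k)\big)_m$. It is $\mathbb{Z}$-graded with degree-$k$ part $\hat{A}(g^kx,y)$. An isomorphism of $\mathbb{Z}$-graded categories $\mathcal{B}\to\mathcal{A}$ is an isomorphism of categories $H$ that is degree-preserving, i.e. for some map $r\colon\mathcal{B}_0\to\mathbb{Z}$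 one has $H(\mathcal{B}^{r_y+a}(x,y))\subseteq\mathcal{A}^{a+r_x}(Hx,Hy)$ for all $x,y\in\mathcal{B}_0$, $a\in\mathbb{Z}$. *)

(* Defs.v *)
From HB Require Import structures.
From mathcomp Require Import all_boot all_order all_algebra all_field.
From mathcomp Require Import mathcomp_extra boolp classical_sets functions.
From mathcomp Require Import cardinality fsbigop zify.

Set Implicit Arguments.
Unset Strict Implicit.
Unset Printing Implicit Defensive.

Import GRing.Theory.
Local Open Scope classical_set_scope.
Local Open Scope ring_scope.
Local Obligation Tactic := idtac.

Record lincat (k : fieldType) : Type := LinCat {
  obj :> Type;
  hom : obj -> obj -> lmodType k;
  idm : forall x, hom x x;
  comp : forall x y z, hom y z -> hom x y -> hom x z;
  comp_linl : forall x y z (f : hom x y), linear (fun g : hom y z => comp g f);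
  comp_linr : forall x y z (g : hom y z), linear (fun f : hom x y => comp g f);
  comp1m : forall x y (f : hom x y), comp (idm y) f = f;
  compm1 : forall x y (f : hom x y), comp f (idm x) = f;
  compA : forall x y z t (h : hom z t) (g : hom y z) (f : hom x y),
    comp h (comp g f) = comp (comp h g) f }.

(* Equality of morphisms whose end points are only propositionally equal is
   equality in the type of all arrows. *)
Definition arrow k (C : lincat k) : Type := {xy : C * C & hom xy.1 xy.2}.
Definition arr k (C : lincat k) (x y : C) (f : hom x y) : arrow C :=
  existT (fun xy : C * C => GRing.Lmodule.sort (hom xy.1 xy.2)) (x, y) f.

Record functor k (C D : lincat k) : Type := Functor {
  fobj :> C -> D;
  fmap : forall x y : C, {linear hom x y -> hom (fobj x) (fobj y)};
  fmap1 : forall x, fmap x x (idm x) = idm (fobj x);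
  fmapM : forall (x y z : C) (g : hom y z) (f : hom x y),
    fmap x z (comp g f) = comp (fmap y z g) (fmap x y f) }.

Section Functors.
Variable k : fieldType.

Definition fid (C : lincat k) : functor C C :=
  @Functor k C C id (fun x y => idfun) (fun=> erefl) (fun _ _ _ _ _ => erefl).

Program Definition fcomp (C D E : lincat k) (G : functor D E) (F : functor C D) :
    functor C E :=
  @Functor k C E (fun x => G (F x)) (fun x y => fmap G (F x) (F y) \o fmap F x y) _ _.
Next Obligation. by move=> C D E G F x /=; rewrite !fmap1. Qed.
Next Obligation. by move=> C D E G F x y z g f /=; rewrite !fmapM. Qed.

End Functors.

(* Isomorphisms of categories, with their inverse; an automorphism of C is an
   element of [iso C C]. *)
Record iso k (C D : lincat k) : Type := Iso {
  isof :> functor C D;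
  isoinv : functor D C;
  isoK : forall (x y : C) (f : hom x y), arr (fmap isoinv _ _ (fmap isof _ _ f)) = arr f;
  isoinvK : forall (x y : D) (f : hom x y),
    arr (fmap isof _ _ (fmap isoinv _ _ f)) = arr f }.

Section Isos.
Variable k : fieldType.

Definition amap (C D : lincat k) (F : functor C D) (u : arrow C) : arrow D :=
  arr (fmap F _ _ (projT2 u)).

Lemma amap_arr (C D : lincat k) (F : functor C D) (x y : C) (f : hom x y) :
  amap F (arr f) = arr (fmap F _ _ f).
Proof. by []. Qed.

Lemma arrE (C : lincat k) (u : arrow C) : u = arr (projT2 u).
Proof. by case: u => -[x y] f. Qed.

Lemma arr_inj (C : lincat k) (x y : C) (f g : hom x y) : arr f = arr g -> f = g.
Proof.
move=> e; have := projT2_eq e => /=.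
by rewrite (Prop_irrelevance (projT1_eq e) erefl).
Qed.

Lemma amapK (C D : lincat k) (F : iso C D) : cancel (amap F) (amap (isoinv F)).
Proof. by move=> u; rewrite [RHS]arrE -(isoK F). Qed.

Lemma amapVK (C D : lincat k) (F : iso C D) : cancel (amap (isoinv F)) (amap F).
Proof. by move=> u; rewrite [RHS]arrE -(isoinvK F). Qed.

Definition iid (C : lincat k) : iso C C :=
  @Iso k C C (fid C) (fid C) (fun _ _ _ => erefl) (fun _ _ _ => erefl).

Definition iinv (C D : lincat k) (F : iso C D) : iso D C :=
  @Iso k D C (isoinv F) F (@isoinvK k C D F) (@isoK k C D F).

Program Definition icomp (C D E : lincat k) (G : iso D E) (F : iso C D) : iso C E :=
  @Iso k C E (fcomp G F) (fcomp (isoinv F) (isoinv G)) _ _.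
Next Obligation.
move=> C D E G F x y f.
exact: etrans (congr1 (amap (isoinv F)) (isoK G (fmap F _ _ f))) (isoK F f).
Qed.
Next Obligation.
move=> C D E G F x y f.
exact: etrans (congr1 (amap G) (isoinvK F (fmap (isoinv G) _ _ f))) (isoinvK G f).
Qed.

Fixpoint iiter (C : lincat k) (g : iso C C) (n : nat) : iso C C :=
  if n is n'.+1 then icomp g (iiter g n') else iid C.

Definition ipow (C : lincat k) (g : iso C C) (n : int) : iso C C :=
  match n with Posz m => iiter g m | Negz m => iiter (iinv g) m.+1 end.

Section Pow.
Variables (C : lincat k) (g : iso C C).

Lemma amap_ipowS n u : amap (ipow g (n + 1)) u = amap g (amap (ipow g n) u).
Proof.
case: n => [n|[|n]]; first by rewrite -PoszD addn1.
  rewrite (_ : Negz 0 + 1 = 0) //; case: u => -[x y] f.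
  exact: esym (isoinvK g f).
rewrite (_ : Negz n.+1 + 1 = Negz n); last by rewrite !NegzE; lia.
exact: esym (amapVK g (amap (ipow g (Negz n)) u)).
Qed.

Lemma amap_ipowB n u :
  amap (ipow g (n - 1)) u = amap (isoinv g) (amap (ipow g n) u).
Proof. by apply: (can_inj (amapK g)); rewrite amapVK -amap_ipowS subrK. Qed.

Lemma amap_ipowD m n u : amap (ipow g (m + n)) u = amap (ipow g m) (amap (ipow g n) u).
Proof.
elim: m => [|m IH|m IH] in u *; first by rewrite add0r; exact: arrE.
  by rewrite -addn1 PoszD addrAC amap_ipowS IH amap_ipowS.
by rewrite -addn1 PoszD opprD addrAC amap_ipowB IH amap_ipowB.
Qed.

Lemma ipowD m n x : ipow g m (ipow g n x) = ipow g (m + n) x.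
Proof. exact: esym (congr1 (fun u => (projT1 u).1) (amap_ipowD m n (arr (idm x)))). Qed.

End Pow.
End Isos.

(* Finite-dimensional left modules. *)
Record module (k : fieldType) (A : falgType k) : Type := Module {
  mcar :> vectType k;
  mact : 'Hom(A, 'End(mcar));
  mact1 : forall v, mact 1 v = v;
  mactM : forall a b v, mact (a * b) v = mact a (mact b v) }.

Definition mlinear (k : fieldType) (A : falgType k) (M N : module A) (f : 'Hom(M, N)) : Prop :=
  forall a v, f (mact M a v) = mact N a (f v).

Definition projective (k : fieldType) (A : falgType k) (P : module A) : Prop :=
  forall (M N : module A) (g : 'Hom(M, N)) (h : 'Hom(P, N)),
    mlinear g -> mlinear h -> limg g = fullv ->
  exists2 l : 'Hom(P, M), mlinear l & (g \o l)%VF = h.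

Definition hereditary (k : fieldType) (A : falgType k) : Prop :=
  forall (P N : module A) (i : 'Hom(N, P)),
    mlinear i -> injective i -> projective P -> projective N.

Definition primitive (k : fieldType) (A : falgType k) (e : A) : Prop :=
  [/\ e * e = e, e != 0 &
      forall f g : A, f * f = f -> g * g = g -> f * g = 0 -> g * f = 0 ->
        e = f + g -> f = 0 \/ g = 0].

(* Isomorphism of the left modules A e and A e'. *)
Definition lideal_iso (k : fieldType) (A : falgType k) (e e' : A) : Prop :=
  exists f : 'End(A),
    [/\ forall a u, u \in limg (amulr e) -> f (a * u) = a * f u,
        {in limg (amulr e) &, injective f} &
        (f @: limg (amulr e) = limg (amulr e'))%VS].

(* Basic connected nonzero finite-dimensional algebras, with a fixed complete
   set of orthogonal primitive idempotents. *)
Record bcalg (k : fieldType) : Type := BCAlg {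
  balg :> falgType k;
  vert : finType;
  idem : vert -> balg;
  idem_prim : forall x, primitive (idem x);
  idem_orth : forall x y, x != y -> idem x * idem y = 0;
  idem_sum : \sum_x idem x = 1;
  basicP : forall x y, x != y -> ~ lideal_iso (idem x) (idem y);
  connectedP : forall c : balg, c * c = c -> (forall a, c * a = a * c) ->
    c = 0 \/ c = 1 }.

Section AlgebraCategory.
Variables (k : fieldType) (A : bcalg k).
Implicit Types x y z t w : vert A.

(* A(x, y) = yAx *)
Definition peirce x y : {vspace A} := limg (amulr (idem x) \o amull (idem y))%VF.

Lemma idem_idem x : idem x * idem x = idem x.
Proof. by case: (idem_prim x). Qed.

Lemma peirceP x y (a : A) :
  reflect (idem y * a = a /\ a * idem x = a) (a \in peirce x y).
Proof.
apply: (iffP memv_imgP) => [[b _ ->]|[ya ax]]; last first.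
  by exists a; rewrite ?memvf // !lfunE /= !lfunE /= ya ax.
by rewrite !lfunE /= !lfunE /= !mulrA -[in RHS]mulrA !idem_idem -!mulrA idem_idem.
Qed.

Lemma peirceM x y z (g f : A) :
  g \in peirce y z -> f \in peirce x y -> g * f \in peirce x z.
Proof.
by move=> /peirceP[zg _] /peirceP[_ fx]; apply/peirceP; rewrite mulrA zg -mulrA fx.
Qed.

Lemma idem_peirce x : idem x \in peirce x x.
Proof. by apply/peirceP; rewrite idem_idem. Qed.

Definition ahom x y := subvs_of (peirce x y).
Definition aid x : ahom x x := Subvs (idem_peirce x).
Definition acomp x y z (g : ahom y z) (f : ahom x y) : ahom x z :=
  Subvs (peirceM (subvsP g) (subvsP f)).

Fact acomp_linl x y z (f : ahom x y) : linear (fun g : ahom y z => acomp g f).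
Proof. by move=> a g g'; apply: val_inj; rewrite /= mulrDl scalerAl. Qed.
Fact acomp_linr x y z (g : ahom y z) : linear (fun f : ahom x y => acomp g f).
Proof. by move=> a f f'; apply: val_inj; rewrite /= mulrDr scalerAr. Qed.
Fact acomp1m x y (f : ahom x y) : acomp (aid y) f = f.
Proof. by apply: val_inj; case: f => f /= /peirceP[]. Qed.
Fact acompm1 x y (f : ahom x y) : acomp f (aid x) = f.
Proof. by apply: val_inj; case: f => f /= /peirceP[]. Qed.
Fact acompA x y z t (h : ahom z t) (g : ahom y z) (f : ahom x y) :
  acomp h (acomp g f) = acomp (acomp h g) f.
Proof. by apply: val_inj; rewrite /= mulrA. Qed.

Definition acat : lincat k :=
  @LinCat k (vert A) (fun x y => ahom x y) aid acomp acomp_linl acomp_linr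
    acomp1m acompm1 acompA.

End AlgebraCategory.

Section Repetitive.
Variables (k : fieldType) (A : bcalg k).
Implicit Types x y z t w : vert A.

Local Notation "A( x , y )" := (@ahom k A x y) (format "A( x ,  y )").
Definition adual x y := 'Hom(ahom y x, k^o).
Local Notation "DA( x , y )" := (adual x y) (format "DA( x ,  y )").

Definition acompr x y z (f : A(x, y)) (g : A(y, z)) : A(x, z) := acomp g f.

HB.instance Definition _ x y z (g : A(y, z)) :=
  GRing.isLinear.Build k A(x, y) A(x, z) _ (acomp g) (acomp_linr g).
HB.instance Definition _ x y z (f : A(x, y)) :=
  GRing.isLinear.Build k A(y, z) A(x, z) _ (@acompr x y z f) (@acomp_linl k A x y z f).

(* The A-bimodule structure of DA: (b f)(u) = b(fu) and (f b)(u) = b(uf).  An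
   element of D(A(y, x)) is a morphism from x to y. *)
Definition dmulr w x y (b : DA(x, y)) (f : A(w, x)) : DA(w, y) :=
  (b \o linfun (@acomp k A y w x f))%VF.
Definition dmull x y z (f : A(y, z)) (b : DA(x, y)) : DA(x, z) :=
  (b \o linfun (@acompr y z x f))%VF.

Lemma dmulrE w x y (b : DA(x, y)) (f : A(w, x)) u : dmulr b f u = b (acomp f u).
Proof. by rewrite !lfunE /= lfunE. Qed.
Lemma dmullE x y z (f : A(y, z)) (b : DA(x, y)) u : dmull f b u = b (acomp u f).
Proof. by rewrite !lfunE /= lfunE. Qed.

Definition robj := (vert A * int)%type.
Implicit Types p q r s : robj.

Definition rpair x y := (A(x, y) * DA(x, y))%type.

(* A morphism x^[i] -> y^[j] is a pair (f, b) of f in A(x, y) and b in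
   D(A(y, x)), where f = 0 unless j = i and b = 0 unless j = i + 1. *)
Definition rsupp p q : pred (rpair p.1 q.1) := fun u =>
  ((q.2 == p.2) || (u.1 == 0)) && ((q.2 == p.2 + 1) || (u.2 == 0)).
Arguments rsupp : clear implicits.

Fact rsupp_submod p q : submod_closed (rsupp p q).
Proof.
split; first by rewrite unfold_in /rsupp /= !eqxx !orbT.
move=> a u v; rewrite !unfold_in /rsupp /=.
case: (q.2 == p.2) => /=; case: (q.2 == _) => //=.
- by move=> /eqP-> /eqP->; rewrite scaler0 addr0.
- by rewrite !andbT => /eqP-> /eqP->; rewrite scaler0 addr0.
by move=> /andP[/eqP-> /eqP->] /andP[/eqP-> /eqP->]; rewrite !scaler0 !addr0 !eqxx.
Qed.
HB.instance Definition _ p q :=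
  GRing.isSubmodClosed.Build k (rpair p.1 q.1) (rsupp p q) (@rsupp_submod p q).

Record rhom p q := RHom { rval : rpair p.1 q.1; rvalP : rsupp p q rval }.

HB.instance Definition _ p q := [isSub for @rval p q].
HB.instance Definition _ p q := [Choice of rhom p q by <:].
HB.instance Definition _ p q := [SubChoice_isSubLmodule of rhom p q by <:].

Definition rcomp_val p q r (v : rpair q.1 r.1) (u : rpair p.1 q.1) : rpair p.1 r.1 :=
  (acomp v.1 u.1, dmulr v.2 u.1 + dmull v.1 u.2).

Fact rid_supp p : rsupp p p (aid p.1, 0).
Proof. by rewrite /rsupp /= !eqxx !orbT. Qed.

Lemma acomp0l x y z (f : A(x, y)) : acomp (0 : A(y, z)) f = 0.
Proof. exact: (linear0 (acompr f)). Qed.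
Lemma acomp0r x y z (g : A(y, z)) : acomp g (0 : A(x, y)) = 0.
Proof. exact: (linear0 (acomp g)). Qed.
Lemma dmulr0 w x y (b : DA(x, y)) : dmulr b (0 : A(w, x)) = 0.
Proof. by apply/lfunP => u; rewrite dmulrE acomp0l linear0 lfunE. Qed.
Lemma dmul0r w x y (f : A(w, x)) : dmulr (0 : DA(x, y)) f = 0.
Proof. by rewrite /dmulr comp_lfun0l. Qed.
Lemma dmul0l x y z (b : DA(x, y)) : dmull (0 : A(y, z)) b = 0.
Proof. by apply/lfunP => u; rewrite dmullE acomp0r linear0 lfunE. Qed.
Lemma dmull0 x y z (f : A(y, z)) : dmull f (0 : DA(x, y)) = 0.
Proof. by rewrite /dmull comp_lfun0l. Qed.

Fact rcomp_supp p q r (v : rhom q r) (u : rhom p q) :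
  rsupp p r (rcomp_val (rval v) (rval u)).
Proof.
case: v u => [[v1 v2] /=]; rewrite /rsupp /= => /andP[V1 V2] [[u1 u2] /= /andP[/= U1 U2]].
apply/andP; split.
  case/orP: V1 => [/eqP->|/eqP->]; last by rewrite acomp0l eqxx orbT.
  by case/orP: U1 => [->|/eqP->] //; rewrite acomp0r eqxx orbT.
have [//|ne] /= := eqVneq r.2 (p.2 + 1); rewrite (_ : dmulr v2 u1 = 0).
  rewrite add0r; case/orP: V1 => [/eqP e|/eqP->]; last by rewrite dmul0l.
  by case/orP: U2 => [/eqP e'|/eqP->]; [rewrite e e' eqxx in ne | rewrite dmull0].
case/orP: V2 => [/eqP e|/eqP->]; last by rewrite dmul0r.
by case/orP: U1 => [/eqP e'|/eqP->]; [rewrite e e' eqxx in ne | rewrite dmulr0].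
Qed.

Definition rid p : rhom p p := RHom (rid_supp p).
Definition rcomp p q r (v : rhom q r) (u : rhom p q) : rhom p r :=
  RHom (rcomp_supp v u).

Fact rcomp_linl p q r (u : rhom p q) : linear (fun v : rhom q r => rcomp v u).
Proof.
move=> a v v'; apply: val_inj => /=; rewrite /rcomp_val.
set u' := rval u; congr pair; first exact: (linearP (acompr u'.1)).
apply/lfunP=> w; rewrite /= !(add_lfunE, scale_lfunE, dmulrE, dmullE) /=.
rewrite (linearP (acomp _)) linearP /= scalerDr.
by rewrite addrACA.
Qed.
Fact rcomp_linr p q r (v : rhom q r) : linear (fun u : rhom p q => rcomp v u).
Proof.
move=> a u u'; apply: val_inj => /=; rewrite /rcomp_val.
set v' := rval v; congr pair; first exact: (linearP (acomp v'.1)).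
apply/lfunP=> w; rewrite /= !(add_lfunE, scale_lfunE, dmulrE, dmullE) /=.
rewrite [acomp (_ + _) w](linearP (acompr w)) linearP /= scalerDr.
by rewrite addrACA.
Qed.
Fact rcomp1m p q (u : rhom p q) : rcomp (rid q) u = u.
Proof.
apply: val_inj; case: u => -[u1 u2] /= _; rewrite /rcomp_val /= acomp1m dmul0r add0r.
by congr pair; apply/lfunP => w; rewrite dmullE acompm1.
Qed.
Fact rcompm1 p q (u : rhom p q) : rcomp u (rid p) = u.
Proof.
apply: val_inj; case: u => -[u1 u2] /= _; rewrite /rcomp_val /= acompm1 dmull0 addr0.
by congr pair; apply/lfunP => w; rewrite dmulrE acomp1m.
Qed.
Fact rcompA p q r s (w : rhom r s) (v : rhom q r) (u : rhom p q) :
  rcomp w (rcomp v u) = rcomp (rcomp w v) u.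
Proof.
apply: val_inj; case: w v u => [[w1 w2] _] [[v1 v2] _] [[u1 u2] _] /=.
rewrite /rcomp_val /= acompA; congr pair; apply/lfunP => t.
by rewrite !(add_lfunE, dmulrE, dmullE) !acompA addrA.
Qed.

Definition rcat : lincat k :=
  @LinCat k robj (fun p q => rhom p q) rid rcomp rcomp_linl rcomp_linr
    rcomp1m rcompm1 rcompA.

End Repetitive.
Arguments rsupp {k A} p q _.

Section IsoLemmas.
Variables (k : fieldType) (C D : lincat k) (F : iso C D).

Lemma isoK_obj (x : C) : isoinv F (F x) = x.
Proof. exact: (congr1 (fun u : arrow C => (projT1 u).1) (isoK F (idm x))). Qed.

Lemma isoinvK_obj (x : D) : F (isoinv F x) = x.
Proof. exact: (congr1 (fun u : arrow D => (projT1 u).1) (isoinvK F (idm x))). Qed.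

Lemma iso_fmap_inj (x y : C) : injective (fmap F x y).
Proof.
move=> f g e; apply: arr_inj; apply: (can_inj (amapK F)).
by rewrite !amap_arr e.
Qed.

Lemma iso_fmap_surj (x y : C) (g : hom (F x) (F y)) : exists f, fmap F x y f = g.
Proof.
suff H x' y' (h : hom x' y') : x' = x -> y' = y -> arr (fmap F _ _ h) = arr g ->
    exists f, fmap F x y f = g.
  by apply: (H _ _ (fmap (isoinv F) _ _ g)); rewrite ?isoK_obj ?isoinvK.
by move=> ex ey; case: x / ex g; case: y / ey => g /arr_inj <-; exists h.
Qed.

End IsoLemmas.

Section RepetitiveAutomorphisms.
Variables (k : fieldType) (A : bcalg k).
Implicit Types x y z t w : vert A.
Implicit Types p q r : robj A.

Definition rpair_arr x y (u : rpair x y) : {xy : vert A * vert A & rpair xy.1 xy.2} :=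
  existT (fun xy : vert A * vert A => rpair xy.1 xy.2) (x, y) u.

Lemma rarr_eq p q p' q' (u : rhom p q) (u' : rhom p' q') :
  p.2 = p'.2 -> q.2 = q'.2 -> rpair_arr (rval u) = rpair_arr (rval u') ->
  @arr k (rcat A) p q u = @arr k (rcat A) p' q' u'.
Proof.
case: p u => x i; case: q => y j; case: p' u' => x' i'; case: q' => y' j' /= u' u.
move=> ei ej e; case: i' / ei u' e => u'; case: j' / ej u' => u' e.
have [ex ey] : x = x' /\ y = y' by case: (congr1 (@projT1 _ _) e).
case: x' / ex u' e => u'; case: y' / ey u' => u' e.
congr arr; apply: val_inj; have := projT2_eq e => /=.
by rewrite (Prop_irrelevance (projT1_eq e) erefl).
Qed.

Definition rshift (d : int) p : robj A := (p.1, p.2 + d).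

Fact rshift_supp d p q (u : rhom p q) : rsupp (rshift d p) (rshift d q) (rval u).
Proof.
case: u => u /=; rewrite /rsupp /= => /andP[u1 u2].
by rewrite addrAC !(inj_eq (addIr d)) u1 u2.
Qed.
Definition rshift_hom d p q (u : rhom p q) : rhom (rshift d p) (rshift d q) :=
  RHom (rshift_supp d u).
Fact rshift_linear d p q : linear (@rshift_hom d p q).
Proof. by move=> a u v; apply: val_inj. Qed.
HB.instance Definition _ d p q :=
  GRing.isLinear.Build k (rhom p q) (rhom (rshift d p) (rshift d q)) _
    (@rshift_hom d p q) (@rshift_linear d p q).

Program Definition rshift_functor d : functor (rcat A) (rcat A) :=
  @Functor k (rcat A) (rcat A) (rshift d) (fun p q => @rshift_hom d p q) _ _.
Next Obligation. by move=> d p; apply: val_inj. Qed.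
Next Obligation. by move=> d p q r v u; apply: val_inj. Qed.

Program Definition nakayama : iso (rcat A) (rcat A) :=
  @Iso k (rcat A) (rcat A) (rshift_functor 1) (rshift_functor (-1)) _ _.
Next Obligation. by move=> p q u; apply: rarr_eq; rewrite //= addrK. Qed.
Next Obligation. by move=> p q u; apply: rarr_eq; rewrite //= subrK. Qed.

(* The embedding id^[i] : A -> A^[i], with values in the repetitive category. *)
Fact rincl_supp (i : int) x y (f : ahom x y) : rsupp (x, i) (y, i) (f, 0).
Proof. by rewrite /rsupp /= !eqxx !orbT. Qed.
Definition rincl_hom i x y (f : ahom x y) : rhom (x, i) (y, i) :=
  RHom (rincl_supp i f).
Fact rincl_linear i x y : linear (@rincl_hom i x y).
Proof. by move=> a u v; apply: val_inj; rewrite /= -[in LHS](addr0 0) -{1}(scaler0 _ a). Qed.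
HB.instance Definition _ i x y :=
  GRing.isLinear.Build k (ahom x y) (rhom (x, i) (y, i)) _
    (@rincl_hom i x y) (@rincl_linear i x y).
Program Definition rincl i : functor (acat A) (rcat A) :=
  @Functor k (acat A) (rcat A) (fun x => (x, i)) (fun x y => @rincl_hom i x y) _ _.
Next Obligation. by move=> i x; apply: val_inj. Qed.
Next Obligation.
move=> i x y z g f; apply: val_inj => /=; rewrite /rcomp_val /=.
by rewrite dmul0r dmull0 addr0.
Qed.

(* The functor forgetting the index and killing DA; it restricts to the inverse
   of id^[i] on A^[i]. *)
Definition rproj_hom p q (u : rhom p q) : ahom p.1 q.1 := (rval u).1.
Fact rproj_linear p q : linear (@rproj_hom p q).
Proof. by []. Qed.
HB.instance Definition _ p q :=
  GRing.isLinear.Build k (rhom p q) (ahom p.1 q.1) _ (@rproj_hom p q) (@rproj_linear p q).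
Program Definition rproj : functor (rcat A) (acat A) :=
  @Functor k (rcat A) (acat A) (fun p => p.1) (fun p q => @rproj_hom p q) _ _.
Next Obligation. by []. Qed.
Next Obligation. by []. Qed.

Lemma rinclK i x y (f : ahom x y) : fmap rproj _ _ (fmap (rincl i) x y f) = f.
Proof. by []. Qed.

Lemma rprojK i p q (u : rhom p q) : p.2 = i -> q.2 = i ->
  arr (fmap (rincl i) _ _ (fmap rproj p q u)) = @arr k (rcat A) p q u.
Proof.
move=> pi qi; apply: rarr_eq => //=; congr rpair_arr.
case: u => -[u1 u2] uP; rewrite /rproj_hom /=; case/andP: uP => _ /=.
by rewrite pi qi -{1}[i]addr0 (inj_eq (addrI i)) /= => /eqP->.
Qed.

(* phi has jump n when phi (A^[0]) = A^[n]; as A^[i] is a full subcategory it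
   is determined by its objects. *)
Definition layer (i : int) : set (rcat A) := [set p | p.2 = i].
Definition has_jump (phi : iso (rcat A) (rcat A)) (n : int) : Prop :=
  (fun p => phi p) @` layer 0 = layer n.

Lemma idem_neq0 x : aid x != 0.
Proof. by rewrite -val_eqE /=; case: (idem_prim x). Qed.

Lemma rhom_succ x i : exists u : rhom (x, i) (x, i + 1), u != 0.
Proof.
have [j jP] : exists j, coord (vbasis {:ahom x x}) j (aid x) != 0.
  apply/existsP; apply: contraNT (idem_neq0 x); rewrite negb_exists => /forallP H.
  rewrite (coord_vbasis (memvf (aid x))) big1 // => j _.
  by move: (H j); rewrite negbK => /eqP->; rewrite scale0r.
pose b : adual x x := linfun (coord (vbasis {:ahom x x}) j : ahom x x -> k^o).
have bP : rsupp (x, i) (x, i + 1) (0, b) by rewrite /rsupp /= !eqxx !orbT.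
exists (RHom bP); rewrite -val_eqE /=; apply: contraNneq jP => -[b0].
by have := congr1 (fun h : adual x x => h (aid x)) b0; rewrite !lfunE /= => ->.
Qed.

Lemma rhom_neq0 p q (u : rhom p q) : u != 0 -> q.2 = p.2 \/ q.2 = p.2 + 1.
Proof.
rewrite -val_eqE /=; case: u => -[u1 u2] /= /andP[/= /orP[/eqP|/eqP->]]; first by left.
by case/orP => [/eqP|/eqP->]; [right | rewrite eqxx].
Qed.

Lemma iso_rhom_neq0 (phi : iso (rcat A) (rcat A)) p q (u : rhom p q) :
  u != 0 -> (phi q).2 = (phi p).2 \/ (phi q).2 = (phi p).2 + 1.
Proof.
move=> u0; apply: (@rhom_neq0 _ _ (fmap phi p q u)); apply: contra_neq u0 => u0.
by apply: (@iso_fmap_inj _ _ _ phi p q); rewrite u0 linear0.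
Qed.

Lemma jump_layers phi n : has_jump phi n ->
  forall i, (fun p => phi p) @` layer i = layer (i + n).
Proof.
move=> hn.
have step (phi' : iso (rcat A) (rcat A)) m i : (fun p => phi' p) @` layer i = layer m ->
  ((forall p, p.2 = i + 1 -> (phi' p).2 = m + 1) /\
   (forall p, p.2 = i - 1 -> (phi' p).2 = m - 1)).
  move=> e; have inj : injective phi' by move=> p q e'; rewrite -(isoK_obj phi' p) e' isoK_obj.
  have le p : p.2 = i -> (phi' p).2 = m.
    by move=> pi; suff: layer m (phi' p) by []; rewrite -e; exists p.
  have ge p : (phi' p).2 = m -> p.2 = i.
    by move=> pm; have: layer m (phi' p) by []; rewrite -e => -[p' <- /inj->].
  split=> -[x j] /= ->.
    have [u /(iso_rhom_neq0 phi')[]] := rhom_succ x i; rewrite (le (x, i)) //.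
    by move=> /ge /= /eqP; rewrite -subr_eq0 addrAC subrr add0r oner_eq0.
  have [u /(iso_rhom_neq0 phi')[]] := rhom_succ x (i - 1); rewrite subrK (le (x, i)) //.
    by move=> /esym /ge /= /eqP; rewrite -subr_eq0 addrAC subrr add0r oppr_eq0 oner_eq0.
  by move=> ->; rewrite addrK.
have inv (phi' : iso (rcat A) (rcat A)) i m : (fun p => phi' p) @` layer i = layer m ->
    (fun p => isoinv phi' p) @` layer m = layer i.
  move=> e; rewrite -e; apply/seteqP; split=> p.
    by case=> _ [q qi <-] <-; rewrite isoK_obj.
  by move=> pi; exists (phi' p); [exists p | rewrite isoK_obj].
have both i m d : d = 1 \/ d = -1 -> (fun p => phi p) @` layer i = layer m ->
    (fun p => phi p) @` layer (i + d) = layer (m + d).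
  move=> hd e; have [s1 s2] := step _ _ _ e.
  have [t1 t2] := step (iinv phi) _ _ (inv _ _ _ e).
  apply/seteqP; split=> p.
    by case=> q qi <-; case: hd => dE; rewrite dE in qi *; [exact: s1 | exact: s2].
  move=> pm; exists (isoinv phi p); last exact: isoinvK_obj.
  by case: hd => dE; rewrite dE in pm *; [exact: t1 | exact: t2].
case; elim=> [|i IH]; first by rewrite add0r.
- by rewrite -addn1 PoszD addrAC; apply: both IH; left.
- by rewrite (_ : Negz 0 = 0 - 1) // addrAC; apply: both; [right | rewrite add0r].
rewrite (_ : Negz i.+1 = Negz i - 1); last by rewrite !NegzE; lia.
by rewrite addrAC; apply: both IH; right.
Qed.

Lemma jump_index phi n p : has_jump phi n -> (phi p).2 = p.2 + n.
Proof.
move=> /jump_layers/(_ p.2) e; suff: layer (p.2 + n) (phi p) by [].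
by rewrite -e; exists p.
Qed.

Lemma ipow_nakayama n p : ipow nakayama n p = rshift n p.
Proof.
have up m : iiter nakayama m p = rshift m p :> robj A.
  elim: m => [|m /= ->]; first by case: p => x i; rewrite /rshift /= addr0.
  by rewrite /rshift /= -addrA -PoszD addn1.
have down m : iiter (iinv nakayama) m p = rshift (- m%:Z) p :> robj A.
  elim: m => [|m /= ->]; first by case: p {up} => x i; rewrite /rshift /= oppr0 addr0.
  by rewrite /rshift /= -addrA -opprD -PoszD addn1.
by case: n => n; [exact: up | exact: down].
Qed.

Section Phi0.
Variables (phi : iso (rcat A) (rcat A)) (n : int) (hn : has_jump phi n).

Program Definition phi0 : iso (acat A) (acat A) :=
  @Iso k (acat A) (acat A)
    (fcomp rproj (fcomp phi (fcomp (ipow nakayama (- n)) (rincl 0))))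
    (fcomp rproj (fcomp (ipow nakayama n) (fcomp (isoinv phi) (rincl 0)))) _ _.
Next Obligation.
move=> x y f.
set N := ipow nakayama n; set N' := ipow nakayama (- n).
set u := fmap phi _ _ (fmap N' _ _ (fmap (rincl 0) _ _ f)).
have e : arr (fmap (rincl 0) _ _ (fmap rproj _ _ u)) = arr u.
  by apply: rprojK; rewrite (jump_index _ hn) ipow_nakayama /= add0r addNr.
transitivity (amap rproj (amap N (amap (isoinv phi) (arr (fmap (rincl 0) _ _ (fmap rproj _ _ u)))))) => //.
rewrite e /u -!(amap_arr phi) amapK -(amap_arr N') -amap_ipowD subrr.
by [].
Qed.
Next Obligation.
move=> x y f.
set N := ipow nakayama n; set N' := ipow nakayama (- n).
set u := fmap N _ _ (fmap (isoinv phi) _ _ (fmap (rincl 0) _ _ f)).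
have e : arr (fmap (rincl 0) _ _ (fmap rproj _ _ u)) = arr u.
  by apply: rprojK; rewrite ipow_nakayama /= -(jump_index _ hn) isoinvK_obj.
transitivity (amap rproj (amap phi (amap N' (arr (fmap (rincl 0) _ _ (fmap rproj _ _ u)))))) => //.
rewrite e /u -!(amap_arr N) -amap_ipowD addNr.
by transitivity (amap rproj (amap phi (amap (isoinv phi) (arr (fmap (rincl 0) _ _ f))))) => //; rewrite amapVK.
Qed.

End Phi0.

Section Hat.

(* [(restr s x y)^-1] is a two-sided inverse when s is an automorphism, which is
   the only case in which [hat_val] is used (see [hat_functor]). *)
Definition restr (s : functor (acat A) (acat A)) x y : 'Hom(ahom x y, ahom (s x) (s y)) :=
  linfun (fmap s x y : ahom x y -> ahom (s x) (s y)).
Definition hat_obj (s : functor (acat A) (acat A)) p : robj A := (s p.1, p.2).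
Definition hat_val (s : functor (acat A) (acat A)) x y (u : rpair x y) :
    rpair (s x : vert A) (s y) :=
  (fmap s x y u.1, (u.2 \o (restr s y x)^-1)%VF).

Fact hat_supp s p q (u : rhom p q) : rsupp (hat_obj s p) (hat_obj s q) (hat_val s (rval u)).
Proof.
case: u => -[u1 u2] /=; rewrite /rsupp /= => /andP[].
move=> /orP[->|/eqP->] /orP[->|/eqP->] //=; rewrite ?linear0 ?comp_lfun0l ?eqxx ?orbT //.
Qed.
Definition hat_hom s p q (u : rhom p q) : rhom (hat_obj s p) (hat_obj s q) :=
  RHom (hat_supp s u).
Fact hat_linear s p q : linear (@hat_hom s p q).
Proof.
move=> a u v; apply: val_inj; rewrite /= /hat_val /= linearP /=.
by rewrite comp_lfunDl -comp_lfunZl.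
Qed.
HB.instance Definition _ s p q :=
  GRing.isLinear.Build k (rhom p q) (rhom (hat_obj s p) (hat_obj s q)) _
    (@hat_hom s p q) (@hat_linear s p q).

Variable s : iso (acat A) (acat A).

Lemma restrK x y : cancel (restr s x y) (restr s x y)^-1%VF.
Proof.
apply: lker0_lfunK; apply/lker0P => f g; rewrite !lfunE /=.
exact: (@iso_fmap_inj _ _ _ s x y).
Qed.

Lemma restr_surj x y (g : ahom (s x) (s y)) : exists f, restr s x y f = g.
Proof.
have [f fg] := @iso_fmap_surj _ _ _ s x y g.
by exists f; rewrite lfunE.
Qed.

Program Definition hat_functor : functor (rcat A) (rcat A) :=
  @Functor k (rcat A) (rcat A) (hat_obj s) (fun p q => @hat_hom s p q) _ _.
Next Obligation.
move=> p; apply: val_inj; rewrite /= /hat_val /= comp_lfun0l; congr pair.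
exact: (fmap1 s).
Qed.
Next Obligation.
move=> p q r v u; apply: val_inj; rewrite /= /hat_val /rcomp_val /=.
case: v u => -[v1 v2] /= _ [[u1 u2] /= _].
congr pair; first exact: (fmapM s).
apply/lfunP => g; have [f <-] := restr_surj g.
rewrite [LHS]comp_lfunE restrK !add_lfunE !(dmulrE, dmullE).
have E x y z (b : ahom y z) (a : ahom x y) :
    acomp (fmap s y z b) (fmap s x y a) = restr s x z (acomp b a).
  by rewrite lfunE /=; apply: esym; exact: (fmapM s b a).
by rewrite [restr s _ _ f]lfunE /= !E !comp_lfunE !restrK.
Qed.

End Hat.

Lemma hat_cancel (s t : iso (acat A) (acat A)) :
  (forall u : arrow (acat A), amap t (amap s u) = u) ->
  forall p q (u : rhom p q),
    @arr k (rcat A) _ _ (hat_hom t (hat_hom s u)) = @arr k (rcat A) p q u.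
Proof.
move=> ts p q [u uP]; apply: rarr_eq => //=.
case: u {uP} => a b; rewrite /hat_val /=.
set a' := fmap t _ _ (fmap s _ _ a); set b' := (_ \o _)%VF.
pose r (u : ahom q.1 p.1) : ahom (t (s q.1)) (t (s p.1)) := restr t _ _ (restr s _ _ u).
have bE u : b' (r u) = b u by rewrite !comp_lfunE !restrK.
have aE : @arr k (acat A) _ _ a' = @arr k (acat A) _ _ a by exact: (ts (@arr k (acat A) _ _ a)).
have uE (u : ahom q.1 p.1) : @arr k (acat A) _ _ (r u) = @arr k (acat A) _ _ u.
  have -> : r u = fmap t _ _ (fmap s _ _ u) by rewrite /r !lfunE.
  exact: (ts (@arr k (acat A) _ _ u)).
clearbody a' b' r.
have ex : t (s p.1) = p.1 by exact: (congr1 (fun u : arrow (acat A) => (projT1 u).1) aE).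
have ey : t (s q.1) = q.1 by exact: (congr1 (fun u : arrow (acat A) => (projT1 u).2) aE).
move: (t (s p.1)) (t (s q.1)) ex ey a' b' aE r bE uE => x y ex ey.
subst x y => a' b' /arr_inj -> r rE uE.
congr (rpair_arr (_, _)); apply/lfunP => u; rewrite -rE; congr (b' _).
by apply: (@arr_inj k (acat A)); rewrite uE.
Qed.

Program Definition hat (s : iso (acat A) (acat A)) : iso (rcat A) (rcat A) :=
  @Iso k (rcat A) (rcat A) (hat_functor s) (hat_functor (iinv s)) _ _.
Next Obligation. by move=> s p q u; apply: hat_cancel; exact: (amapK s). Qed.
Next Obligation. by move=> s p q u; apply: hat_cancel; exact: (amapVK s). Qed.

End RepetitiveAutomorphisms.

Section Casts.
Variables (k : fieldType) (C : lincat k).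

Definition cast_src (x x' y : C) (e : x = x') (f : hom x y) : hom x' y :=
  eq_rect x (fun z => GRing.Lmodule.sort (hom z y)) f x' e.

Lemma arr_cast (x x' y : C) (e : x = x') (f : hom x y) : arr (cast_src e f) = arr f.
Proof. by case: x' / e. Qed.

Lemma cast_src_linear (x x' y : C) (e : x = x') : linear (@cast_src x x' y e).
Proof. by case: x' / e. Qed.
HB.instance Definition _ x x' y e :=
  GRing.isLinear.Build k (hom x y) (hom x' y) _ (@cast_src x x' y e)
    (@cast_src_linear x x' y e).

Lemma arr_comp (x y z x' y' z' : C) (g : hom y z) (f : hom x y)
    (g' : hom y' z') (f' : hom x' y') :
  arr g = arr g' -> arr f = arr f' -> arr (comp g f) = arr (comp g' f').
Proof.
move=> eg ef.
have ex : x = x' by exact: (congr1 (fun u : arrow C => (projT1 u).1) ef).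
have ey : y = y' by exact: (congr1 (fun u : arrow C => (projT1 u).2) ef).
have ez : z = z' by exact: (congr1 (fun u : arrow C => (projT1 u).2) eg).
by subst; rewrite (arr_inj eg) (arr_inj ef).
Qed.

Lemma comp0l (x y z : C) (f : hom x y) : comp (0 : hom y z) f = 0.
Proof. by rewrite -(subrr 0) -scaleN1r addrC (comp_linl f) scaleN1r addNr. Qed.

Lemma comp0r (x y z : C) (g : hom y z) : comp g (0 : hom x y) = 0.
Proof. by rewrite -(subrr 0) -scaleN1r addrC (comp_linr g) scaleN1r addNr. Qed.

Lemma comp_suml (x y z : C) I (s : seq I) (F : I -> hom y z) (f : hom x y) :
  comp (\sum_(i <- s) F i) f = \sum_(i <- s) comp (F i) f.
Proof.
apply: (big_morph (fun g => comp g f)); last exact: comp0l.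
by move=> a b; have := comp_linl f 1 a b; rewrite !scale1r.
Qed.

Lemma comp_sumr (x y z : C) I (s : seq I) (F : I -> hom x y) (g : hom y z) :
  comp g (\sum_(i <- s) F i) = \sum_(i <- s) comp g (F i).
Proof.
apply: (big_morph (comp g)); last exact: comp0r.
by move=> a b; have := comp_linr g 1 a b; rewrite !scale1r.
Qed.

End Casts.

Lemma fsum_seq (V : nmodType) (F : int -> V) (s : seq int) :
  uniq s -> (forall i, i \notin s -> F i = 0) ->
  \sum_(i \in [set: int]) F i = \sum_(i <- s) F i.
Proof.
move=> us sF; rewrite (fsbigE s) //; last by move=> i _; exact: sF.
by apply: eq_bigl => i; rewrite in_setT.
Qed.

Lemma fsum_single (V : nmodType) (F : int -> V) (n : int) :
  (forall i, i != n -> F i = 0) -> \sum_(i \in [set: int]) F i = F n.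
Proof.
move=> F0; rewrite (@fsum_seq _ _ [:: n]) ?big_seq1 // => i.
by rewrite inE; exact: F0.
Qed.

Section Orbit.
Variables (k : fieldType) (C : lincat k) (g : iso C C).

Definition orbit_of (x : C) : set C := [set y | exists n : int, y = ipow g n x].
Definition orb : Type := {O : set C | exists x, O = orbit_of x}.

Record orbit_reps : Type := OrbitReps {
  rep :> orb -> C;
  repP : forall O : orb, sval O (rep O) }.

(* The direct sum over n of the hom (g^n x) y. *)
Record ohom (x y : C) : Type := OHom {
  opart : forall n : int, hom (ipow g n x) y;
  ofin : finite_set [set n | opart n <> 0] }.

Section OHomModule.
Variables x y : C.
Implicit Types u v : ohom x y.

Lemma ohomP u v : (forall n, opart u n = opart v n) -> u = v.
Proof.
case: u v => u Pu [v Pv] /= H.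
have e : u = v by apply: functional_extensionality_dep.
by subst v; rewrite (Prop_irrelevance Pu Pv).
Qed.

Lemma osupp u : exists2 s : seq int, uniq s & forall n, n \notin s -> opart u n = 0.
Proof.
have /finite_seqP[s sE] := ofin u; exists (undup s); first exact: undup_uniq.
move=> n; rewrite mem_undup => ns; apply: contrapT => un.
have : [set` s] n by rewrite -sE.
by rewrite /= (negbTE ns).
Qed.

Lemma ofin_seq (f : forall n : int, hom (ipow g n x) y) (s : seq int) :
  (forall n, n \notin s -> f n = 0) -> finite_set [set n | f n <> 0].
Proof.
move=> H; apply: (sub_finite_set _ (finite_seq s)) => n fn /=.
by apply: contrapT => /negP /H.
Qed.

Fact ozero_fin : finite_set [set n : int | (0 : hom (ipow g n x) y) <> 0].
Proof. exact: (@ofin_seq (fun=> 0) [::]). Qed.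
Definition ozero : ohom x y := OHom ozero_fin.

Fact oopp_fin u : finite_set [set n | - opart u n <> 0].
Proof.
by have [s _ us] := osupp u; apply: (@ofin_seq _ s) => n /us ->; rewrite oppr0.
Qed.
Definition oopp u : ohom x y := OHom (oopp_fin u).

Fact oadd_fin u v : finite_set [set n | opart u n + opart v n <> 0].
Proof.
have [s _ us] := osupp u; have [t _ vt] := osupp v.
apply: (@ofin_seq _ (s ++ t)) => n; rewrite mem_cat negb_or => /andP[/us -> /vt ->].
by rewrite addr0.
Qed.
Definition oadd u v : ohom x y := OHom (oadd_fin u v).

Fact oscale_fin (a : k) u : finite_set [set n | a *: opart u n <> 0].
Proof.
by have [s _ us] := osupp u; apply: (@ofin_seq _ s) => n /us ->; rewrite scaler0.
Qed.
Definition oscale a u : ohom x y := OHom (oscale_fin a u).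

Fact oaddA : associative oadd.
Proof. by move=> u v w; apply: ohomP => n /=; rewrite addrA. Qed.
Fact oaddC : commutative oadd.
Proof. by move=> u v; apply: ohomP => n /=; rewrite addrC. Qed.
Fact oadd0 : left_id ozero oadd.
Proof. by move=> u; apply: ohomP => n /=; rewrite add0r. Qed.
Fact oaddN : left_inverse ozero oopp oadd.
Proof. by move=> u; apply: ohomP => n /=; rewrite addNr. Qed.

HB.instance Definition _ := gen_eqMixin (ohom x y).
HB.instance Definition _ := gen_choiceMixin (ohom x y).
HB.instance Definition _ := GRing.isZmodule.Build (ohom x y) oaddA oaddC oadd0 oaddN.

Fact oscaleA a b u : oscale a (oscale b u) = oscale (a * b) u.
Proof. by apply: ohomP => n /=; rewrite scalerA. Qed.
Fact oscale1 : left_id 1 oscale.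
Proof. by move=> u; apply: ohomP => n /=; rewrite scale1r. Qed.
Fact oscaleDr : right_distributive oscale +%R.
Proof. by move=> a u v; apply: ohomP => n /=; rewrite scalerDr. Qed.
Fact oscaleDl u : {morph oscale^~ u : a b / a + b}.
Proof. by move=> a b; apply: ohomP => n /=; rewrite scalerDl. Qed.

HB.instance Definition _ :=
  GRing.Zmodule_isLmodule.Build k (ohom x y) oscaleA oscale1 oscaleDr oscaleDl.

Lemma opart_sum I (s : seq I) (F : I -> ohom x y) n :
  opart (\sum_(i <- s) F i) n = \sum_(i <- s) opart (F i) n.
Proof. exact: (big_morph (fun u => opart u n)). Qed.

End OHomModule.

Lemma ipowBD (m l : int) (x : C) : ipow g l (ipow g (m - l) x) = ipow g m x.
Proof. by rewrite ipowD addrC subrK. Qed.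

(* The degree m part of q f is the sum over l + k = m of q_l g^l(f_k). *)
Definition ocomp_term x y z (q : ohom y z) (f : ohom x y) (m l : int) :
    hom (ipow g m x) z :=
  comp (opart q l)
    (cast_src (ipowBD m l x) (fmap (ipow g l) _ _ (opart f (m - l)))).
Definition ocomp_part x y z (q : ohom y z) (f : ohom x y) (m : int) :
    hom (ipow g m x) z :=
  \sum_(l \in [set: int]) ocomp_term q f m l.

Lemma ocomp_term0l x y z (q : ohom y z) (f : ohom x y) m l :
  opart q l = 0 -> ocomp_term q f m l = 0.
Proof. by rewrite /ocomp_term => ->; rewrite comp0l. Qed.

Lemma ocomp_term0r x y z (q : ohom y z) (f : ohom x y) m l :
  opart f (m - l) = 0 -> ocomp_term q f m l = 0.
Proof. by rewrite /ocomp_term => ->; rewrite !linear0 comp0r. Qed.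

Fact ocomp_fin x y z (q : ohom y z) (f : ohom x y) :
  finite_set [set m | ocomp_part q f m <> 0].
Proof.
have [s us qs] := osupp q; have [t _ ft] := osupp f.
apply: (@ofin_seq _ _ _ [seq l + n | l <- s, n <- t]) => m ms.
rewrite /ocomp_part (fsum_seq us); last by move=> l /qs; exact: ocomp_term0l.
rewrite big_seq big1 // => l ls; apply/ocomp_term0r/ft; apply: contra ms => mt.
by apply/allpairsP; exists (l, m - l); rewrite /= [l + _]addrC subrK.
Qed.
Definition ocomp x y z (q : ohom y z) (f : ohom x y) : ohom x z := OHom (ocomp_fin q f).

Definition oid_part (x : C) (n : int) : hom (ipow g n x) x :=
  match n with Posz 0 => idm x | _ => 0 end.
Fact oid_fin x : finite_set [set n | oid_part x n <> 0].
Proof. by apply: (@ofin_seq _ _ _ [:: 0]) => -[[|n]|n]. Qed.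
Definition oid x : ohom x x := OHom (oid_fin x).

Fact ocomp_linl x y z (f : ohom x y) : linear (fun q : ohom y z => ocomp q f).
Proof.
move=> a q q'; apply: ohomP => m /=; rewrite /ocomp_part.
have [s _ qs] := osupp q; have [t _ qt] := osupp q'.
have H n : n \notin undup (s ++ t) -> opart q n = 0 /\ opart q' n = 0.
  by rewrite mem_undup mem_cat negb_or => /andP[/qs -> /qt ->].
rewrite !(@fsum_seq _ _ (undup (s ++ t))) ?undup_uniq //.
- rewrite scaler_sumr -big_split /=; apply: eq_bigr => l _.
  exact: (comp_linl (cast_src _ _)).
- by move=> l /H[_ ?]; exact: ocomp_term0l.
- by move=> l /H[? _]; exact: ocomp_term0l.
by move=> l /H[e e']; apply: ocomp_term0l; rewrite /= e e' scaler0 addr0.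
Qed.

Fact ocomp_linr x y z (q : ohom y z) : linear (fun f : ohom x y => ocomp q f).
Proof.
move=> a f f'; apply: ohomP => m /=; rewrite /ocomp_part.
have [s us qs] := osupp q.
rewrite !(fsum_seq us); try by move=> l /qs; exact: ocomp_term0l.
rewrite scaler_sumr -big_split /=; apply: eq_bigr => l _.
by rewrite /ocomp_term /= !linearP; exact: (comp_linr (opart q l)).
Qed.

Lemma arr_opart x y (f : ohom x y) n n' : n = n' -> arr (opart f n) = arr (opart f n').
Proof. by move->. Qed.

Fact ocomp1m x y (f : ohom x y) : ocomp (oid y) f = f.
Proof.
apply: ohomP => m /=; rewrite /ocomp_part (@fsum_single _ _ 0); last first.
  by case=> [[|l]|l] // _; exact: ocomp_term0l.
rewrite /ocomp_term comp1m; apply: arr_inj.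
rewrite arr_cast; exact: (arr_opart f (subr0 m)).
Qed.

Fact ocompm1 x y (f : ohom x y) : ocomp f (oid x) = f.
Proof.
apply: ohomP => m /=; rewrite /ocomp_part (@fsum_single _ _ m); last first.
  move=> l lm; apply: ocomp_term0r => /=; have : m - l != 0 by rewrite subr_eq0 eq_sym.
  by case: (m - l) => [[|?]|?].
apply: arr_inj; rewrite /ocomp_term -[in RHS](compm1 (opart f m)).
apply: arr_comp => //; rewrite arr_cast -(fmap1 (ipow g m)).
rewrite -!(amap_arr (ipow g m)); congr amap.
by transitivity (arr (opart (oid x) 0)) => //; apply: arr_opart; rewrite subrr.
Qed.

Fact ocompA x y z t (h : ohom z t) (q : ohom y z) (f : ohom x y) :
  ocomp h (ocomp q f) = ocomp (ocomp h q) f.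
Proof.
apply: ohomP => m /=.
have [sh uh hs] := osupp h; have [sq uq qs] := osupp q.
pose sL := undup [seq j + l | j <- sh, l <- sq].
have hq0 l : l \notin sL -> forall j, j \in sh -> opart q (l - j) = 0.
  move=> lL j js; apply: qs; apply: contra lL => lj; rewrite mem_undup.
  by apply/allpairsP; exists (j, l - j); rewrite /= [j + _]addrC subrK.
have hqE l : opart (ocomp h q) l = \sum_(j <- sh) ocomp_term h q l j.
  by rewrite /= /ocomp_part (fsum_seq uh) // => j /hs; exact: ocomp_term0l.
rewrite /ocomp_part (fsum_seq uh); last by move=> j /hs; exact: ocomp_term0l.
rewrite [RHS](@fsum_seq _ _ sL) ?undup_uniq //; last first.
  move=> l lL; apply: ocomp_term0l; rewrite hqE big_seq big1 // => j js.
  exact/ocomp_term0r/hq0.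
pose T j l : hom (ipow g m x) t := comp (ocomp_term h q l j)
  (cast_src (ipowBD m l x) (fmap (ipow g l) _ _ (opart f (m - l)))).
rewrite [RHS](_ : _ = \sum_(l <- sL) \sum_(j <- sh) T j l); last first.
  by apply: eq_bigr => l _; rewrite /ocomp_term hqE comp_suml.
rewrite exchange_big /= big_seq [RHS]big_seq; apply: eq_bigr => j js.
rewrite -(@fsum_seq _ (T j)) ?undup_uniq //; last first.
  by move=> l lL; rewrite /T ocomp_term0r ?comp0l //; exact: hq0.
rewrite (@reindex_fsbigT _ _ _ _ _ (fun l => j + l)); last first.
  by exists (fun l => - j + l) => l; rewrite addrA ?addNr ?subrr add0r.
rewrite (fsum_seq uq); last first.
  by move=> l /qs ql; rewrite /T ocomp_term0r ?comp0l // addrAC subrr add0r.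
rewrite {1}/ocomp_term /= /ocomp_part (fsum_seq uq); last first.
  by move=> l /qs; exact: ocomp_term0l.
rewrite !linear_sum comp_sumr; apply: eq_bigr => l _.
rewrite /T /ocomp_term -compA; apply: arr_inj; apply: arr_comp => //.
rewrite arr_cast fmapM; apply: arr_comp.
  rewrite arr_cast -!(amap_arr (ipow g j)); congr amap; apply: arr_opart.
  by rewrite addrAC subrr add0r.
rewrite arr_cast -(amap_arr (ipow g j)) arr_cast -(amap_arr (ipow g l)) -amap_ipowD.
by rewrite -(amap_arr (ipow g (j + l))); congr amap; apply: arr_opart; rewrite opprD addrA.
Qed.

Definition ocat (R : orbit_reps) : lincat k :=
  @LinCat k orb (fun X Y => ohom (R X) (R Y)) (fun X => oid (R X))
    (fun X Y Z => @ocomp (R X) (R Y) (R Z))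
    (fun X Y Z => @ocomp_linl (R X) (R Y) (R Z))
    (fun X Y Z => @ocomp_linr (R X) (R Y) (R Z))
    (fun X Y => @ocomp1m (R X) (R Y)) (fun X Y => @ocompm1 (R X) (R Y))
    (fun X Y Z T => @ocompA (R X) (R Y) (R Z) (R T)).

End Orbit.

(* Z-graded linear categories: every morphism space is the direct sum of its
   homogeneous parts [gdeg n]. *)
Record gradedcat (k : fieldType) : Type := GradedCat {
  gcat :> lincat k;
  gdeg : forall x y : gcat, int -> hom x y -> Prop;
  gdeg0 : forall (x y : gcat) n, gdeg n (0 : hom x y);
  gdegZD : forall (x y : gcat) n (a : k) (f f' : hom x y),
    gdeg n f -> gdeg n f' -> gdeg n (a *: f + f');
  gdeg1 : forall x : gcat, gdeg 0 (idm x);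
  gdegM : forall (x y z : gcat) m n (h : hom y z) (f : hom x y),
    gdeg m h -> gdeg n f -> gdeg (m + n) (comp h f);
  gdeg_sum : forall (x y : gcat) (f : hom x y),
    exists! c : int -> hom x y,
      [/\ finite_set [set n | c n <> 0], forall n, gdeg n (c n) &
          f = \sum_(n \in [set: int]) c n] }.

Section OrbitGrading.
Variables (k : fieldType) (C : lincat k) (g : iso C C) (R : orbit_reps g).
Implicit Types X Y Z : ocat R.

Definition odeg X Y (n : int) (f : hom X Y) : Prop :=
  forall m, m <> n -> opart (f : ohom g (R X) (R Y)) m = 0.

Fact odeg0 X Y n : odeg n (0 : hom X Y).
Proof. by []. Qed.
Fact odegZD X Y n a (f f' : hom X Y) : odeg n f -> odeg n f' -> odeg n (a *: f + f').
Proof. by move=> hf hf' m mn; rewrite /= hf // hf' // scaler0 addr0. Qed.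
Fact odeg1 X : odeg 0 (idm X).
Proof. by case=> [[|m]|m]. Qed.
Fact odegM X Y Z m n (h : hom Y Z) (f : hom X Y) :
  odeg m h -> odeg n f -> odeg (m + n) (comp h f).
Proof.
move=> hm fn i imn; rewrite /= /ocomp_part fsbig1 // => l _.
have [->|lm] := eqVneq l m; last by apply/ocomp_term0l/hm/eqP.
by apply/ocomp_term0r/fn => e; apply: imn; rewrite -e addrC subrK.
Qed.

Definition opick (x y : C) (f : ohom g x y) (n m : int) : hom (ipow g m x) y :=
  if m == n then opart f m else 0.
Fact opick_fin x y (f : ohom g x y) n : finite_set [set m | opick f n m <> 0].
Proof.
by apply: (@ofin_seq _ _ _ _ _ _ [:: n]) => m; rewrite inE /opick; case: eqP.
Qed.
Definition ohomog x y (f : ohom g x y) n : ohom g x y := OHom (opick_fin f n).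

Fact odeg_sum X Y (f : hom X Y) : exists! c : int -> hom X Y,
  [/\ finite_set [set n | c n <> 0], forall n, odeg n (c n) &
      f = \sum_(n \in [set: int]) c n].
Proof.
have fin_seq (c : int -> hom X Y) : finite_set [set n | c n <> 0] ->
    exists2 s : seq int, uniq s & forall n, n \notin s -> c n = 0.
  move=> /finite_seqP[s sE]; exists (undup s); first exact: undup_uniq.
  move=> n; rewrite mem_undup => ns; apply: contrapT => un.
  have : [set` s] n by rewrite -sE.
by rewrite /= (negbTE ns).
exists (fun n => ohomog f n); split; first split.
- have [s _ fs] := osupp f; apply: (sub_finite_set _ (finite_seq s)) => n fn /=.
  apply: contrapT => /negP /fs f0; apply: fn; apply: ohomP => m /=.
  by rewrite /opick; case: eqP => // ->.
- by move=> n m /eqP mn /=; rewrite /opick (negbTE mn).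
- have [s us fs] := osupp f.
  rewrite (fsum_seq us); last first.
    by move=> n /fs f0; apply: ohomP => m /=; rewrite /opick; case: eqP => // ->.
  apply: ohomP => m; apply: (etrans _ (esym (opart_sum s (ohomog f) m))).
  have [ms|ms] := boolP (m \in s).
    rewrite (bigD1_seq m) //= /opick eqxx big1 ?addr0 // => n.
    by rewrite eq_sym => /negbTE ->.
  by rewrite fs // big1 // => n _ /=; rewrite /opick; case: eqP => // _; exact: fs.
move=> c [/fin_seq[s us cs] cdeg fE]; apply/funext => n; apply: ohomP => m /=.
rewrite /opick; case: eqP => [->|/eqP mn]; last by rewrite cdeg //; exact/eqP.
rewrite fE (fsum_seq us) //; apply: (etrans (opart_sum s c n)); have [ns|ns] := boolP (n \in s).
  rewrite (bigD1_seq n) //= big1 ?addr0 // => i /eqP in_.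
  by apply: cdeg => e; apply: in_.
rewrite cs // big1_seq // => i /= is_; apply: cdeg => e; move: ns.
by rewrite e is_.
Qed.

Definition orbit_cat : gradedcat k :=
  @GradedCat k (ocat R) odeg odeg0 odegZD odeg1 odegM odeg_sum.

End OrbitGrading.

Definition graded_isomorphic (k : fieldType) (B A : gradedcat k) : Prop :=
  exists (H : iso B A) (r : B -> int), forall (x y : B) (a : int) (f : hom x y),
    gdeg (r y + a) f -> gdeg (a + r x) (fmap H x y f).

Section TwistedExtension.
Variables (k : fieldType) (A : bcalg k).

Definition twist (n : int) (s : iso (acat A) (acat A)) : iso (rcat A) (rcat A) :=
  icomp (hat s) (ipow (nakayama A) n).

Definition twisted_ext (n : int) (s : iso (acat A) (acat A))
  (R : orbit_reps (twist n s)) : gradedcat k := orbit_cat R.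

End TwistedExtension.

Section Complexes.
Variables (k : fieldType) (A : falgType k).

(* Bounded (cochain) complexes of finite-dimensional modules. *)
Record complex : Type := Complex {
  cob :> int -> module A;
  cdiff : forall i, 'Hom(cob i, cob (i + 1));
  cdiff_lin : forall i, mlinear (cdiff i);
  cdiffK : forall i v, cdiff (i + 1) (cdiff i v) = 0;
  cbounded : exists N : nat, forall i : int, (N < absz i)%N -> \dim {:cob i} = 0%N }.

Record chmap (X Y : complex) : Type := ChMap {
  chm :> forall i, 'Hom(X i, Y i);
  chm_lin : forall i, mlinear (chm i);
  chm_comm : forall i v, chm (i + 1) (cdiff X i v) = cdiff Y i (chm i v) }.

(* s induces isomorphisms H^(i+1)(X) -> H^(i+1)(Y) for all i. *)
Definition quasi_iso (X Y : complex) (s : chmap X Y) : Prop :=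
  forall i,
    (forall v : X (i + 1), cdiff X (i + 1) v = 0 ->
       s (i + 1) v \in limg (cdiff Y i) -> v \in limg (cdiff X i)) /\
    (forall w : Y (i + 1), cdiff Y (i + 1) w = 0 ->
       exists2 v : X (i + 1), cdiff X (i + 1) v = 0 &
         w - s (i + 1) v \in limg (cdiff Y i)).

Program Definition ch_id (X : complex) : chmap X X := @ChMap X X (fun i => \1%VF) _ _.
Next Obligation. by move=> X i a v; rewrite !lfunE. Qed.
Next Obligation. by move=> X i v; rewrite !lfunE. Qed.

Program Definition ch_comp (X Y Z : complex) (g : chmap Y Z) (f : chmap X Y) :
  chmap X Z := @ChMap X Z (fun i => (g i \o f i)%VF) _ _.
Next Obligation. by move=> X Y Z g f i a v; rewrite !comp_lfunE !chm_lin. Qed.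
Next Obligation. by move=> X Y Z g f i v; rewrite !comp_lfunE !chm_comm. Qed.

Program Definition ch_add (X Y : complex) (f g : chmap X Y) : chmap X Y :=
  @ChMap X Y (fun i => f i + g i) _ _.
Next Obligation. by move=> X Y f g i a v; rewrite !add_lfunE !chm_lin linearD. Qed.
Next Obligation. by move=> X Y f g i v; rewrite !add_lfunE !chm_comm linearD. Qed.

Program Definition ch_scale (X Y : complex) (c : k) (f : chmap X Y) : chmap X Y :=
  @ChMap X Y (fun i => c *: f i) _ _.
Next Obligation. by move=> X Y c f i a v; rewrite !scale_lfunE !chm_lin linearZ. Qed.
Next Obligation. by move=> X Y c f i v; rewrite !scale_lfunE !chm_comm linearZ. Qed.

(* X[1], with (X[1])^i = X^(i+1) and the opposite differential. *)
Program Definition shift (X : complex) : complex :=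
  @Complex (fun i => X (i + 1)) (fun i => - cdiff X (i + 1)) _ _ _.
Next Obligation. by move=> X i a v; rewrite !opp_lfunE cdiff_lin linearN. Qed.
Next Obligation. by move=> X i v /=; rewrite !opp_lfunE linearN /= cdiffK !oppr0. Qed.
Next Obligation.
by move=> X; have [N HN] := cbounded X; exists N.+1 => i Hi; apply: HN; lia.
Qed.

Program Definition ch_shift (X Y : complex) (f : chmap X Y) : chmap (shift X) (shift Y) :=
  @ChMap (shift X) (shift Y) (fun i => f (i + 1)) _ _.
Next Obligation. by move=> X Y f i; exact: (@chm_lin X Y f (i + 1)). Qed.
Next Obligation. by move=> X Y f i v; rewrite /= !opp_lfunE linearN /= chm_comm. Qed.

Lemma limg_opp (U V : vectType k) (f : 'Hom(U, V)) : limg (- f) = limg f.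
Proof.
suff sub (h : 'Hom(U, V)) : (limg h <= limg (- h))%VS.
  by apply/eqP; rewrite eqEsubv sub andbT -{2}(opprK f) sub.
apply/subvP => _ /memv_imgP[v _ ->].
have -> : h v = (- h) (- v) by rewrite opp_lfunE linearN opprK.
exact: memv_img (memvf _).
Qed.

Lemma quasi_iso_shift (X Y : complex) (s : chmap X Y) :
  quasi_iso s -> quasi_iso (ch_shift s).
Proof.
move=> qs i; have [inj surj] := qs (i + 1); split=> /=.
  move=> v; rewrite !limg_opp opp_lfunE => /eqP; rewrite oppr_eq0 => /eqP.
  exact: inj.
move=> w; rewrite !limg_opp opp_lfunE => /eqP; rewrite oppr_eq0 => /eqP /surj[v v0 wv].
by exists v; rewrite ?opp_lfunE ?v0 ?oppr0.
Qed.

Definition msum_act (M N : module A) (a : A) (v : M * N) : M * N :=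
  (mact M a v.1, mact N a v.2).
Fact msum_act_linear (M N : module A) a : linear (@msum_act M N a).
Proof. by move=> c u v; rewrite /msum_act /= !linearP. Qed.
HB.instance Definition _ (M N : module A) (a : A) :=
  GRing.isLinear.Build k (M * N)%type (M * N)%type _ (@msum_act M N a)
    (@msum_act_linear M N a).
Definition msum_mact (M N : module A) (a : A) : 'End((M * N)%type) :=
  linfun (@msum_act M N a).
Fact msum_mact_linear (M N : module A) : linear (@msum_mact M N).
Proof.
move=> c a b; apply/lfunP => v; rewrite add_lfunE scale_lfunE !lfunE /=.
by rewrite /msum_act !linearP !add_lfunE !scale_lfunE.
Qed.
HB.instance Definition _ (M N : module A) :=
  GRing.isLinear.Build k A 'End((M * N)%type) _ (@msum_mact M N)
    (@msum_mact_linear M N).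
Program Definition msum (M N : module A) : module A :=
  @Module k A (M * N)%type (linfun (@msum_mact M N)) _ _.
Next Obligation. by move=> M N [u v]; rewrite !lfunE /= /msum_act /= !mact1. Qed.
Next Obligation.
by move=> M N a b [u v]; rewrite !lfunE /= /msum_act /= !mactM.
Qed.

Lemma msumE (M N : module A) a (v : msum M N) :
  mact (msum M N) a v = (mact M a v.1, mact N a v.2).
Proof. by rewrite !lfunE. Qed.

Section Cone.
Variables (X Y : complex) (f : chmap X Y).

Definition cone_ob i : module A := msum (X (i + 1)) (Y i).
Definition cone_d i (v : cone_ob i) : cone_ob (i + 1) :=
  (- cdiff X (i + 1) v.1, f (i + 1) v.1 + cdiff Y i v.2).
Fact cone_d_linear i : linear (@cone_d i).
Proof.
move=> c u v; rewrite /cone_d /= !linearP /=; congr pair => /=.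
by rewrite scalerDr addrACA.
Qed.
HB.instance Definition _ i :=
  GRing.isLinear.Build k (cone_ob i) (cone_ob (i + 1)) _ (@cone_d i) (@cone_d_linear i).

Fact cone_dE i (v : cone_ob i) : linfun (@cone_d i) v = cone_d v.
Proof. exact: lfunE. Qed.

Program Definition cone : complex :=
  @Complex cone_ob (fun i => linfun (@cone_d i)) _ _ _.
Next Obligation.
move=> i a v; rewrite !cone_dE /cone_ob !msumE /cone_d /=.
by rewrite !cdiff_lin chm_lin linearN linearD.
Qed.
Next Obligation.
move=> i v; rewrite !cone_dE /cone_d /= !linearN linearD /= !cdiffK.
by rewrite oppr0 oppr0 addr0 chm_comm addNr.
Qed.
Next Obligation.
have [N HN] := cbounded X; have [M HM] := cbounded Y; exists (N + M).+1 => i Hi.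
have X0 : \dim {:X (i + 1)} = 0%N by apply: HN; lia.
have Y0 : \dim {:Y i} = 0%N by apply: HM; lia.
apply/eqP; rewrite dimv_eq0 -subv0; apply/subvP => -[u v] _; rewrite memv0.
move/eqP: X0; rewrite dimv_eq0 => /eqP X0; move/eqP: Y0; rewrite dimv_eq0 => /eqP Y0.
have: u \in (fullv : {vspace X (i + 1)}) by exact: memvf.
have: v \in (fullv : {vspace Y i}) by exact: memvf.
by rewrite X0 Y0 !memv0 => /eqP-> /eqP->.
Qed.

Definition cone_in_fun i (v : Y i) : cone_ob i := (0, v).
Fact cone_in_linear i : linear (@cone_in_fun i).
Proof. by move=> c u v; rewrite /cone_in_fun -[in LHS](addr0 0) -{1}(scaler0 _ c). Qed.
HB.instance Definition _ i :=
  GRing.isLinear.Build k (Y i) (cone_ob i) _ (@cone_in_fun i) (@cone_in_linear i).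
Fact cone_inE i (v : Y i) : linfun (@cone_in_fun i) v = cone_in_fun v.
Proof. exact: lfunE. Qed.
Program Definition cone_in : chmap Y cone :=
  @ChMap Y cone (fun i => linfun (@cone_in_fun i)) _ _.
Next Obligation. by move=> i a v; rewrite !cone_inE /cone_in_fun /cone_ob msumE /= linear0. Qed.
Next Obligation.
by move=> i v; rewrite !cone_inE cone_dE /cone_d /cone_in_fun /= !linear0 ?oppr0 add0r.
Qed.

Definition cone_out_fun i (v : cone_ob i) : X (i + 1) := v.1.
Fact cone_out_linear i : linear (@cone_out_fun i).
Proof. by []. Qed.
HB.instance Definition _ i :=
  GRing.isLinear.Build k (cone_ob i) (X (i + 1)) _ (@cone_out_fun i) (@cone_out_linear i).
Fact cone_outE i (v : cone_ob i) : linfun (@cone_out_fun i) v = cone_out_fun v.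
Proof. exact: lfunE. Qed.
Program Definition cone_out : chmap cone (shift X) :=
  @ChMap cone (shift X) (fun i => linfun (@cone_out_fun i)) _ _.
Next Obligation. by move=> i a v; rewrite !cone_outE /cone_out_fun /cone_ob msumE. Qed.
Next Obligation. by move=> i v; rewrite !cone_outE cone_dE /cone_out_fun /= opp_lfunE. Qed.

End Cone.

(* The bounded derived category is the k-linear localization of the category of
   bounded complexes at the quasi-isomorphisms, given by generators and
   relations: [dmor X Y] modulo [deq] is Hom(X, Y). *)
Inductive dmor : complex -> complex -> Type :=
| dq X Y (f : chmap X Y) : dmor X Y
| dinv X Y (s : chmap X Y) (qs : quasi_iso s) : dmor Y X
| dcomp X Y Z (g : dmor Y Z) (f : dmor X Y) : dmor X Z
| dzero X Y : dmor X Y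
| dadd X Y (f g : dmor X Y) : dmor X Y
| dscale X Y (c : k) (f : dmor X Y) : dmor X Y.

Definition did (X : complex) : dmor X X := dq (ch_id X).

Inductive deq : forall X Y, dmor X Y -> dmor X Y -> Prop :=
| deq_refl X Y (f : dmor X Y) : deq f f
| deq_sym X Y (f g : dmor X Y) : deq f g -> deq g f
| deq_trans X Y (f g h : dmor X Y) : deq f g -> deq g h -> deq f h
| deq_comp X Y Z (g g' : dmor Y Z) (f f' : dmor X Y) :
    deq g g' -> deq f f' -> deq (dcomp g f) (dcomp g' f')
| deq_add X Y (f f' g g' : dmor X Y) :
    deq f f' -> deq g g' -> deq (dadd f g) (dadd f' g')
| deq_scale X Y c (f f' : dmor X Y) : deq f f' -> deq (dscale c f) (dscale c f')
| deq_1m X Y (f : dmor X Y) : deq (dcomp (did Y) f) f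
| deq_m1 X Y (f : dmor X Y) : deq (dcomp f (did X)) f
| deq_compA X Y Z T (h : dmor Z T) (g : dmor Y Z) (f : dmor X Y) :
    deq (dcomp h (dcomp g f)) (dcomp (dcomp h g) f)
| deq_addA X Y (f g h : dmor X Y) : deq (dadd f (dadd g h)) (dadd (dadd f g) h)
| deq_addC X Y (f g : dmor X Y) : deq (dadd f g) (dadd g f)
| deq_add0 X Y (f : dmor X Y) : deq (dadd (dzero X Y) f) f
| deq_addN X Y (f : dmor X Y) : deq (dadd (dscale (-1) f) f) (dzero X Y)
| deq_scaleA X Y a b (f : dmor X Y) : deq (dscale a (dscale b f)) (dscale (a * b) f)
| deq_scale1 X Y (f : dmor X Y) : deq (dscale 1 f) f
| deq_scaleDr X Y a (f g : dmor X Y) :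
    deq (dscale a (dadd f g)) (dadd (dscale a f) (dscale a g))
| deq_scaleDl X Y a b (f : dmor X Y) :
    deq (dscale (a + b) f) (dadd (dscale a f) (dscale b f))
| deq_compDl X Y Z (g g' : dmor Y Z) (f : dmor X Y) :
    deq (dcomp (dadd g g') f) (dadd (dcomp g f) (dcomp g' f))
| deq_compDr X Y Z (g : dmor Y Z) (f f' : dmor X Y) :
    deq (dcomp g (dadd f f')) (dadd (dcomp g f) (dcomp g f'))
| deq_compZl X Y Z c (g : dmor Y Z) (f : dmor X Y) :
    deq (dcomp (dscale c g) f) (dscale c (dcomp g f))
| deq_compZr X Y Z c (g : dmor Y Z) (f : dmor X Y) :
    deq (dcomp g (dscale c f)) (dscale c (dcomp g f))
| deq_q_comp X Y Z (g : chmap Y Z) (f : chmap X Y) :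
    deq (dq (ch_comp g f)) (dcomp (dq g) (dq f))
| deq_q_add X Y (f g : chmap X Y) : deq (dq (ch_add f g)) (dadd (dq f) (dq g))
| deq_q_scale X Y c (f : chmap X Y) : deq (dq (ch_scale c f)) (dscale c (dq f))
| deq_Vm X Y (s : chmap X Y) (qs : quasi_iso s) : deq (dcomp (dinv qs) (dq s)) (did X)
| deq_mV X Y (s : chmap X Y) (qs : quasi_iso s) : deq (dcomp (dq s) (dinv qs)) (did Y).

Fixpoint dshift X Y (f : dmor X Y) : dmor (shift X) (shift Y) :=
  match f with
  | dq _ _ f => dq (ch_shift f)
  | dinv _ _ _ qs => dinv (quasi_iso_shift qs)
  | dcomp _ _ _ g f => dcomp (dshift g) (dshift f)
  | dzero X Y => dzero (shift X) (shift Y)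
  | dadd _ _ f g => dadd (dshift f) (dshift g)
  | dscale _ _ c f => dscale c (dshift f)
  end.

Definition diso X Y (f : dmor X Y) : Prop :=
  exists2 g : dmor Y X, deq (dcomp g f) (did X) & deq (dcomp f g) (did Y).

(* Distinguished triangles: those isomorphic to the triangle of a mapping cone. *)
Definition distinguished X Y Z (f : dmor X Y) (g : dmor Y Z) (h : dmor Z (shift X)) :
    Prop :=
  exists (X' Y' : complex) (u : chmap X' Y')
         (a : dmor X X') (b : dmor Y Y') (c : dmor Z (cone u)),
    [/\ diso a, diso b & diso c] /\
    [/\ deq (dcomp b f) (dcomp (dq u) a),
        deq (dcomp c g) (dcomp (dq (cone_in u)) b) &
        deq (dcomp (dshift a) h) (dcomp (dq (cone_out u)) c)].

End Complexes.

Record derived_equivalence (k : fieldType) (A B : falgType k) : Type := DerivedEquivalence {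
  dob :> complex A -> complex B;
  dmap : forall X Y, dmor X Y -> dmor (dob X) (dob Y);
  dxi : forall X, dmor (dob (shift X)) (shift (dob X));
  dmap_eq : forall X Y (f g : dmor X Y), deq f g -> deq (dmap f) (dmap g);
  dmap_id : forall X, deq (dmap (did X)) (did (dob X));
  dmap_comp : forall X Y Z (g : dmor Y Z) (f : dmor X Y),
    deq (dmap (dcomp g f)) (dcomp (dmap g) (dmap f));
  dmap_add : forall X Y (f g : dmor X Y), deq (dmap (dadd f g)) (dadd (dmap f) (dmap g));
  dmap_scale : forall X Y c (f : dmor X Y), deq (dmap (dscale c f)) (dscale c (dmap f));
  dmap_faithful : forall X Y (f g : dmor X Y), deq (dmap f) (dmap g) -> deq f g;
  dmap_full : forall X Y (g : dmor (dob X) (dob Y)), exists f : dmor X Y, deq (dmap f) g;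
  dob_dense : forall Y : complex B, exists (X : complex A) (f : dmor (dob X) Y), diso f;
  dxi_iso : forall X, diso (dxi X);
  dxi_nat : forall X Y (f : dmor X Y),
    deq (dcomp (dxi Y) (dmap (dshift f))) (dcomp (dshift (dmap f)) (dxi X));
  dmap_triangle : forall X Y Z (f : dmor X Y) (g : dmor Y Z) (h : dmor Z (shift X)),
    distinguished f g h -> distinguished (dmap f) (dmap g) (dcomp (dxi X) (dmap h)) }.

Definition derived_equivalent (k : fieldType) (A B : falgType k) : Prop :=
  inhabited (derived_equivalence A B).

Definition piecewise_hereditary (k : fieldType) (A : bcalg k) : Prop :=
  exists2 H : bcalg k, hereditary H & derived_equivalent A H.

(* Main.v *)
From HB Require Import structures.
From mathcomp Require Import all_boot all_order all_algebra all_field.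
From mathcomp Require Import boolp classical_sets cardinality fsbigop zify.
Require Import Defs.

Set Implicit Arguments.
Unset Strict Implicit.
Unset Printing Implicit Defensive.

Import GRing.Theory.
Local Open Scope ring_scope.

(** Write phi' for the automorphism twist n phi0, that is, hat phi0 composed
with the n-th power of the Nakayama automorphism.  By the definition of phi0,
phi and phi' agree on the layer of index -n, so psi = phi'^-1 phi preserves all
layers and fixes every arrow of the layer -n.  The theorem follows from the
fact that such a psi is naturally isomorphic to the identity.

The isomorphism t : id -> psi is the identity on the layer -n and is extended
one layer at a time in both directions.  Suppose that t is known on layer i and
let q lie in layer i+1.  The maps b |-> psi b o t_p, for p in layer i, send
hom p q to hom p (psi q) and commute with precomposition by the arrows of
layer i.  As these two spaces are duals of morphism spaces of A, Yoneda's lemma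
and the bijection of A with its bidual show that the maps are postcomposition
with a unique arrow t_q : q -> psi q ([postcomp_representable]).  This t_q is
invertible because the maps are, and t remains natural because DA is faithful:
parallel arrows within layer i+1 that agree after precomposition with all the
arrows from layer i are equal ([comp_from_below_inj]).  The extension from
layer i to layer i-1 is dual.  An infinite line has no loops, so there is no
further condition, and the pieces give a natural isomorphism on the whole
repetitive category ([extend_everywhere]).

Applying phi' to t gives a natural isomorphism phi' -> phi.  Moreover p and
psi p are isomorphic objects of the same layer, hence equal because A is basic,
so that phi and phi' agree on objects and have the same orbits.

For automorphisms g and h of any linear category that agree on objects, a
natural isomorphism t : h -> g induces natural isomorphisms
r_m : h^m -> g^m subject to a cocycle rule, and sending a family (f_m) to
(f_m o r_m) identifies the morphism spaces of the two orbit categories,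
preserving degrees and composition.  A different choice of representatives in
an orbit amounts to conjugation by homogeneous invertible elements of the orbit
category; their degrees provide the function r in the definition of a
degree-preserving isomorphism ([orbit_cat_isomorphic]). *)

(** * Invertible morphisms and isomorphisms of categories *)

Lemma int_ind_both (P : int -> Prop) (m : int) : P m ->
  (forall i, P i -> P (i + 1)) -> (forall i, P (i + 1) -> P i) -> forall i, P i.
Proof.
move=> Pm up down i; rewrite -(subrK m i); elim: (i - m) => [|d IH|d IH].
- by rewrite add0r.
- by rewrite -addn1 PoszD addrAC; exact: up.
by apply: down; rewrite -addn1 PoszD opprD addrAC subrK.
Qed.

Section Invertible.
Variables (k : fieldType) (C : lincat k).
Implicit Types x y z : C.

Definition invertible x y (f : hom x y) : Prop :=
  exists g : hom y x, comp g f = idm x /\ comp f g = idm y.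

Lemma invertible_arr x y x' y' (f : hom x y) (f' : hom x' y') :
  arr f = arr f' -> invertible f -> invertible f'.
Proof.
move=> e.
have ex : x = x' by exact: (congr1 (fun u : arrow C => (projT1 u).1) e).
have ey : y = y' by exact: (congr1 (fun u : arrow C => (projT1 u).2) e).
by subst x' y'; rewrite (arr_inj e).
Qed.

Lemma invertible_comp x y z (g : hom y z) (f : hom x y) :
  invertible g -> invertible f -> invertible (comp g f).
Proof.
move=> [g' [g'g gg']] [f' [f'f ff']]; exists (comp f' g'); split.
  by rewrite compA -(compA f') g'g compm1.
by rewrite compA -(compA g) ff' compm1.
Qed.

Lemma comp_invertibleK x y z (g : hom y z) (f f' : hom x y) :
  invertible g -> comp g f = comp g f' -> f = f'.
Proof.
by move=> [g' [g'g _]] e; rewrite -(comp1m f) -g'g -compA e compA g'g comp1m.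
Qed.

Lemma comp_invertibleI x y z (g g' : hom y z) (f : hom x y) :
  invertible f -> comp g f = comp g' f -> g = g'.
Proof.
by move=> [f' [_ ff']] e; rewrite -(compm1 g) -ff' compA e -compA ff' compm1.
Qed.

Lemma invertible_compK x y z (g : hom y z) (f : hom x y) :
  invertible g -> invertible (comp g f) -> invertible f.
Proof.
move=> gi [e [e1 e2]]; exists (comp e g); split; first by rewrite -compA.
by apply: (comp_invertibleK gi); rewrite !compA e2 comp1m compm1.
Qed.

Lemma arr_comp_cancel x y z x' y' z' (g : hom y z) (f : hom x y)
    (g' : hom y' z') (f' : hom x' y') :
  invertible g -> arr g = arr g' -> arr (comp g f) = arr (comp g' f') -> arr f = arr f'.
Proof.
move=> gi eg egf.
have ey : y = y' by exact: (congr1 (fun u : arrow C => (projT1 u).1) eg).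
have ez : z = z' by exact: (congr1 (fun u : arrow C => (projT1 u).2) eg).
have ex : x = x' by exact: (congr1 (fun u : arrow C => (projT1 u).1) egf).
subst x' y' z'; congr arr; apply: (comp_invertibleK gi).
by rewrite [in RHS](arr_inj eg); apply: arr_inj.
Qed.

Lemma arr_idm x x' : x = x' -> arr (idm x) = arr (idm x').
Proof. by move->. Qed.

Lemma invertible_idm x : invertible (idm x).
Proof. by exists (idm x); rewrite comp1m. Qed.

(** Used instead of a cast when end points agree only propositionally. *)
Lemma arr_ex (x y x' y' : C) (f : hom x y) : x = x' -> y = y' ->
  exists f' : hom x' y', arr f' = arr f.
Proof. by move=> ex ey; subst x' y'; exists f. Qed.

Lemma arr_linear x y x' y' (a : k) (f g : hom x y) (f' g' : hom x' y') :
  arr f = arr f' -> arr g = arr g' -> arr (a *: f + g) = arr (a *: f' + g').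
Proof.
move=> ef.
have ex : x = x' by exact: (congr1 (fun u : arrow C => (projT1 u).1) ef).
have ey : y = y' by exact: (congr1 (fun u : arrow C => (projT1 u).2) ef).
by subst x' y' => eg; rewrite (arr_inj ef) (arr_inj eg).
Qed.

End Invertible.

Lemma invertible_fmap (k : fieldType) (C D : lincat k) (F : functor C D)
    (x y : C) (f : hom x y) :
  invertible f -> invertible (fmap F _ _ f).
Proof.
by move=> [g [gf fg]]; exists (fmap F _ _ g); rewrite -!fmapM gf fg !fmap1.
Qed.

Lemma invertible_fmapP (k : fieldType) (C D : lincat k) (F : iso C D) (x y : C) (f : hom x y) :
  invertible (fmap F _ _ f) -> invertible f.
Proof. by move/(invertible_fmap (isoinv F)); exact/invertible_arr/isoK. Qed.

(** The inverse of F on morphisms goes from the spaces hom (F (G x)) (F (G y)),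
which are only propositionally equal to hom x y; it is therefore chosen by its
defining equation between arrows. *)
Lemma iso_of_bijective (k : fieldType) (C D : lincat k) (F : functor C D) (G : D -> C) :
  cancel F G -> cancel G F -> (forall x y, bijective (fmap F x y)) ->
  exists H : iso C D, isof H = F.
Proof.
move=> FK GK bij.
have inj x y : injective (fmap F x y) by exact: bij_inj.
have ex (x y : D) (f : hom x y) :
    {e : hom (G x) (G y) | arr (fmap F _ _ e) = arr f}.
  apply: cid; have [f' <-] := arr_ex f (esym (GK x)) (esym (GK y)).
  by have [h _ hK] := bij (G x) (G y); exists (h f'); rewrite hK.
pose m x y f := sval (ex x y f).
have mE x y f : arr (fmap F _ _ (m x y f)) = arr f by exact: (svalP (ex x y f)).
have m_lin x y : linear (m x y).
  move=> a u v; apply: (inj); apply: arr_inj; rewrite linearP mE.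
  by apply: arr_linear; rewrite mE.
pose mL x y : {linear hom x y -> hom (G x) (G y)} :=
  HB.pack (m x y) (GRing.isLinear.Build k _ _ _ (m x y) (m_lin x y)).
have m1 x : mL x x (idm x) = idm (G x).
  by apply: (inj); apply: arr_inj; rewrite mE fmap1; apply: arr_idm; rewrite GK.
have mM x y z (g : hom y z) (f : hom x y) :
    mL x z (comp g f) = comp (mL y z g) (mL x y f).
  by apply: (inj); apply: arr_inj; rewrite mE fmapM; apply: arr_comp; rewrite mE.
pose F' := @Functor k D C G mL m1 mM.
have FF' (x y : D) (f : hom x y) : arr (fmap F _ _ (fmap F' _ _ f)) = arr f by exact: mE.
have F'F (x y : C) (f : hom x y) : arr (fmap F' _ _ (fmap F _ _ f)) = arr f.
  have [f' f'E] := arr_ex (fmap F' _ _ (fmap F _ _ f)) (FK x) (FK y).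
  rewrite -f'E; congr arr; apply: inj; apply: arr_inj.
  by rewrite -!(amap_arr F) f'E amap_arr FF'.
by exists (@Iso k C D F F' F'F FF').
Qed.

(** * Powers of naturally isomorphic automorphisms *)

Section Powers.
Variables (k : fieldType) (C : lincat k) (g h : iso C C).

Definition natural_iso (D E : lincat k) (F G : functor D E)
    (t : forall x, hom (F x) (G x)) : Prop :=
  (forall x, invertible (t x)) /\
  forall x y (f : hom x y), comp (fmap G _ _ f) (t x) = comp (t y) (fmap F _ _ f).

Variable t : forall x, hom (h x) (g x).
Hypothesis t_nat : natural_iso t.

(** The recursion r_(m+1) = t o h(r_m) over all integers; it determines r, and
each later property of r is proved by going up and down along it. *)
Definition power_family (r : forall (m : int) x, hom (ipow h m x) (ipow g m x)) : Prop :=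
  (forall x, r 0 x = idm x) /\
  forall m x, arr (r (m + 1) x) = arr (comp (t (ipow g m x)) (fmap h _ _ (r m x))).

(** The component at x of the natural isomorphism h^-1 -> g^-1 induced by t:
its image under h is the inverse of the component of t at g^-1 x. *)
Lemma inverse_transport x : { t' : hom (isoinv h x) (isoinv g x) |
  arr (comp (t (isoinv g x)) (fmap h _ _ t')) = arr (idm x) }.
Proof.
apply: cid; have [s [st ts]] := t_nat.1 (isoinv g x).
have [s' s'E] := arr_ex s (etrans (isoinvK_obj g x) (esym (isoinvK_obj h x))) erefl.
have [t' t'E] := iso_fmap_surj s'; exists t'; rewrite t'E.
transitivity (arr (idm (g (isoinv g x)))); last by apply: arr_idm; rewrite isoinvK_obj.
by rewrite -ts; apply: arr_comp.
Qed.

Lemma power_family_exists : exists r, power_family r.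
Proof.
pose t' x := sval (inverse_transport x).
have t'E x : arr (comp (t (isoinv g x)) (fmap h _ _ (t' x))) = arr (idm x).
  exact: svalP (inverse_transport x).
pose up x := fix up n : hom (iiter h n x) (iiter g n x) :=
  if n is n'.+1 then comp (t (iiter g n' x)) (fmap h _ _ (up n')) else idm x.
pose dn x := fix dn n : hom (iiter (iinv h) n x) (iiter (iinv g) n x) :=
  if n is n'.+1 then comp (t' (iiter (iinv g) n' x)) (fmap (isoinv h) _ _ (dn n'))
  else idm x.
pose r (m : int) x : hom (ipow h m x) (ipow g m x) :=
  match m with Posz n => up x n | Negz n => dn x n.+1 end.
have rE x m m' : m = m' -> arr (r m x) = arr (r m' x) by move->.
exists r; split=> // -[n|n] x.
  by rewrite (rE _ _ (Posz n.+1)) // -addn1 PoszD.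
transitivity (arr (dn x n)).
  by case: n => [|n]; [apply: (rE _ _ 0) | apply: (rE _ _ (Negz n)); rewrite !NegzE; lia].
rewrite [r _ x]/= fmapM compA -[dn x n in LHS]comp1m; apply: arr_comp.
  by rewrite t'E.
by rewrite isoinvK.
Qed.

Variable r : forall (m : int) x, hom (ipow h m x) (ipow g m x).
Hypothesis r_pow : power_family r.

Lemma power_family_eq m m' x x' : m = m' -> x = x' -> arr (r m x) = arr (r m' x').
Proof. by move=> -> ->. Qed.

Lemma transport_eq x x' : x = x' -> arr (t x) = arr (t x').
Proof. by move->. Qed.

Lemma power_family_invertible m x : invertible (r m x).
Proof.
move: m; apply: (int_ind_both (m := 0)); first by rewrite r_pow.1; exact: invertible_idm.
  move=> m rm; apply: (invertible_arr (esym (r_pow.2 m x))).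
  by apply: invertible_comp; [exact: t_nat.1 | exact: invertible_fmap].
move=> m /(invertible_arr (r_pow.2 m x)) rm; apply: (invertible_fmapP (F := h)).
exact: invertible_compK (t_nat.1 (ipow g m x)) rm.
Qed.

Lemma power_family_natural m x y (f : hom x y) :
  comp (fmap (ipow g m) _ _ f) (r m x) = comp (r m y) (fmap (ipow h m) _ _ f).
Proof.
apply: arr_inj; move: m; apply: (int_ind_both (m := 0)).
- by rewrite !r_pow.1 compm1 comp1m.
- move=> m IH.
  transitivity (arr (comp (fmap g _ _ (fmap (ipow g m) _ _ f))
                          (comp (t (ipow g m x)) (fmap h _ _ (r m x))))).
    apply: arr_comp; last exact: r_pow.2.
    by rewrite -!(amap_arr (ipow g _)) amap_ipowS.
  transitivity (arr (comp (comp (t (ipow g m y)) (fmap h _ _ (r m y)))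
                          (fmap h _ _ (fmap (ipow h m) _ _ f)))); last first.
    apply: arr_comp; first by rewrite r_pow.2.
    by rewrite -!(amap_arr (ipow h _)) amap_ipowS.
  by rewrite compA t_nat.2 -!compA -!fmapM; rewrite (arr_inj IH).
move=> m IH; congr arr; apply: (@iso_fmap_inj _ _ _ h); rewrite !fmapM.
apply: (comp_invertibleK (t_nat.1 (ipow g m y))).
rewrite !compA -t_nat.2 -compA; apply: arr_inj.
transitivity (arr (comp (fmap (ipow g (m + 1)) x y f) (r (m + 1) x))).
  apply: arr_comp; last by rewrite r_pow.2.
  by rewrite -!(amap_arr (ipow g _)) amap_ipowS.
rewrite IH; apply: arr_comp; first exact: r_pow.2.
by rewrite -!(amap_arr (ipow h _)) amap_ipowS.
Qed.

(** This is what makes [otwist] compatible with composition. *)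
Lemma power_family_cocycle l m x :
  arr (r (l + m) x) = arr (comp (r l (ipow g m x)) (fmap (ipow h l) _ _ (r m x))).
Proof.
move: l; apply: (int_ind_both (m := 0)).
- rewrite r_pow.1 comp1m; transitivity (arr (r m x)) => //.
  exact: (power_family_eq (add0r m) (erefl x)).
- move=> l IH.
  transitivity (arr (comp (t (ipow g (l + m) x)) (fmap h _ _ (r (l + m) x)))).
    by rewrite -r_pow.2; apply: power_family_eq => //; rewrite addrAC.
  transitivity (arr (comp (t (ipow g l (ipow g m x)))
    (fmap h _ _ (comp (r l (ipow g m x)) (fmap (ipow h l) _ _ (r m x)))))).
    apply: arr_comp; first by apply: transport_eq; rewrite ipowD.
    by rewrite -!(amap_arr h) IH.
  rewrite fmapM compA; apply: arr_comp; first by rewrite r_pow.2.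
  by rewrite -!(amap_arr (ipow h _)) amap_ipowS.
move=> l IH; apply: (can_inj (amapK h)).
apply: (arr_comp_cancel (t_nat.1 (ipow g (l + m) x))
          (g' := t (ipow g l (ipow g m x)))).
  by apply: transport_eq; rewrite ipowD.
transitivity (arr (r (l + 1 + m) x)).
  by rewrite -r_pow.2; apply: power_family_eq => //; rewrite addrAC.
rewrite IH /= fmapM compA; apply: arr_comp; first exact: r_pow.2.
by rewrite -!(amap_arr (ipow h _)) amap_ipowS.
Qed.

End Powers.

(** * Orbit categories of naturally isomorphic automorphisms *)

Section Shifts.
Variables (k : fieldType) (C : lincat k) (g : iso C C).
Local Notation ohom := (ohom g).

(** The grading of the orbit category, on the spaces [ohom x y] for all objects
x and y rather than for representatives of orbits; there an object and its
images under g become isomorphic, by the orbit shifts below. *)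
Definition homogeneous (x y : C) (n : int) (f : ohom x y) : Prop :=
  forall m, m <> n -> opart f m = 0.

Lemma homogeneous_comp x y z m n (q : ohom y z) (f : ohom x y) :
  homogeneous m q -> homogeneous n f -> homogeneous (m + n) (ocomp q f).
Proof.
move=> qm fn i imn; rewrite /= /ocomp_part fsbig1 // => l _.
have [->|lm] := eqVneq l m; last by apply/ocomp_term0l/qm/eqP.
by apply/ocomp_term0r/fn => e; apply: imn; rewrite -e addrC subrK.
Qed.

(** The canonical isomorphism of degree n from x to y = g^n x: its only
component is the identity of y, expressed through [arr] because hom (g^n x) y
is not syntactically hom y y. *)
Definition orbit_shift (x y : C) (n : int) (s : ohom x y) : Prop :=
  homogeneous n s /\ arr (opart s n) = arr (idm y).

Lemma orbit_shift_exists x y n : y = ipow g n x -> exists s : ohom x y, orbit_shift n s.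
Proof.
move=> ->; pose s m : hom (ipow g m x) (ipow g n x) :=
  if pselect (m = n) is left e then
    cast_src (congr1 (fun i => ipow g i x) (esym e)) (idm (ipow g n x)) else 0.
have s0 m : m <> n -> s m = 0 by move=> mn; rewrite /s; case: pselect.
have sfin : finite_set [set m | s m <> 0].
  by apply: (@ofin_seq _ _ _ _ _ _ [:: n]) => m; rewrite inE => /eqP /s0.
exists (OHom sfin); split=> //=.
by rewrite /s; case: pselect => // e; rewrite arr_cast.
Qed.

Lemma orbit_shift_comp x y z m n (q : ohom y z) (f : ohom x y) :
  orbit_shift m q -> orbit_shift n f -> orbit_shift (m + n) (ocomp q f).
Proof.
move=> [qm q1] [fn f1]; split; first exact: homogeneous_comp.
rewrite /= /ocomp_part (@fsum_single _ _ m); last by move=> l /eqP /qm; exact: ocomp_term0l.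
rewrite -[in RHS](comp1m (idm z)); apply: arr_comp => //; rewrite arr_cast.
have e : arr (opart f (m + n - m)) = arr (idm y).
  by rewrite -f1; apply: arr_opart; rewrite addrAC subrr add0r.
rewrite -(amap_arr (ipow g m)) e amap_arr fmap1; apply: arr_idm.
exact: (congr1 (fun u : arrow C => (projT1 u).1) q1).
Qed.

Lemma orbit_shift_oid x (s : ohom x x) : orbit_shift 0 s -> s = oid g x.
Proof.
move=> [s0 s1]; apply: ohomP => m; have [->|m0] := eqVneq m 0.
  by apply: arr_inj; exact: s1.
by rewrite s0; [case: m m0 => [[|m]|m] | exact/eqP].
Qed.

Lemma orbit_shift_inverse x y n (s : ohom x y) (t : ohom y x) :
  orbit_shift n s -> orbit_shift (- n) t -> ocomp t s = oid g x /\ ocomp s t = oid g y.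
Proof.
move=> hs ht; split; apply: orbit_shift_oid.
  by rewrite -(addNr n); exact: orbit_shift_comp.
by rewrite -(subrr n); exact: orbit_shift_comp.
Qed.

End Shifts.

Section Twisting.
Variables (k : fieldType) (C : lincat k) (g h : iso C C).
Variable t : forall x, hom (h x) (g x).
Hypothesis t_nat : natural_iso t.
Variable r : forall (m : int) x, hom (ipow h m x) (ipow g m x).
Hypothesis r_pow : power_family t r.

Definition twist_part x y (f : ohom g x y) m : hom (ipow h m x) y :=
  comp (opart f m) (r m x).
Fact twist_fin x y (f : ohom g x y) : finite_set [set m | twist_part f m <> 0].
Proof.
have [s _ fs] := osupp f; apply: (@ofin_seq _ _ _ _ _ _ s) => m /fs fm.
by rewrite /twist_part fm comp0l.
Qed.
Definition otwist x y (f : ohom g x y) : ohom h x y := OHom (twist_fin f).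

Lemma otwist_linear x y : linear (@otwist x y).
Proof. by move=> a u v; apply: ohomP => m; exact: (comp_linl (r m x)). Qed.

Lemma otwist_id x : otwist (oid g x) = oid h x.
Proof.
apply: ohomP => -[[|m]|m] /=; rewrite /twist_part /= ?comp0l //.
by rewrite r_pow.1 comp1m.
Qed.

(** In degree m, the term q_l g^l(f_(m-l)) r_m turns into
q_l r_l h^l(f_(m-l) r_(m-l)) by the cocycle rule and the naturality of r_l. *)
Lemma otwist_comp x y z (q : ohom g y z) (f : ohom g x y) :
  otwist (ocomp q f) = ocomp (otwist q) (otwist f).
Proof.
apply: ohomP => m; rewrite /= /twist_part /= /ocomp_part.
have [s us qs] := osupp q.
rewrite !(fsum_seq us); first last.
- by move=> l /qs; exact: ocomp_term0l.
- by move=> l /qs ql; apply: ocomp_term0l; rewrite /= /twist_part ql comp0l.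
rewrite comp_suml; apply: eq_bigr => l _; rewrite /ocomp_term /= /twist_part.
rewrite -!compA; congr comp; apply: arr_inj.
transitivity (arr (comp (fmap (ipow g l) _ _ (opart f (m - l)))
  (comp (r l (ipow g (m - l) x)) (fmap (ipow h l) _ _ (r (m - l) x))))).
  apply: arr_comp; first by rewrite arr_cast.
  rewrite -(power_family_cocycle t_nat r_pow); apply: power_family_eq => //.
  by rewrite addrC subrK.
rewrite compA (power_family_natural t_nat r_pow) -compA -fmapM.
by apply: arr_comp => //; rewrite arr_cast.
Qed.

Lemma otwist_bijective x y : bijective (@otwist x y).
Proof.
pose r'_ex m := cid (power_family_invertible t_nat r_pow m x).
pose r' m := sval (r'_ex m).
have r'E m : comp (r' m) (r m x) = idm _ /\ comp (r m x) (r' m) = idm _.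
  exact: svalP (r'_ex m).
have fin (f : ohom h x y) : finite_set [set m | comp (opart f m) (r' m) <> 0].
  have [s _ fs] := osupp f; apply: (@ofin_seq _ _ _ _ _ _ s) => m /fs fm.
  by rewrite fm comp0l.
exists (fun f => OHom (fin f)) => f; apply: ohomP => m /=; rewrite /twist_part /=.
  by rewrite -compA (r'E m).2 compm1.
by rewrite -compA (r'E m).1 compm1.
Qed.

Lemma otwist_homogeneous x y m (f : ohom g x y) :
  homogeneous m f -> homogeneous m (otwist f).
Proof. by move=> fm l /fm fl; rewrite /= /twist_part fl comp0l. Qed.

End Twisting.

Section OrbitCategories.
Variables (k : fieldType) (C : lincat k) (g h : iso C C).

Lemma ipow_eq : (forall x, g x = h x) -> forall n x, ipow g n x = ipow h n x.
Proof.
move=> gh n x; move: n; apply: (int_ind_both (m := 0)) => // n.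
  by rewrite ![n + 1]addrC -!ipowD /= => ->; exact: gh.
rewrite ![n + 1]addrC -!ipowD /= -gh => e.
by rewrite -(isoK_obj g (ipow g n x)) e isoK_obj.
Qed.

(** On an orbit O with representatives R O for g and S O = h^(a O) (R O) for h,
the isomorphism is [otwist] conjugated by the orbit shifts s of degree a, which
moves the degrees of morphisms X -> Y by a Y - a X. *)
Lemma orbit_cat_isomorphic (R : orbit_reps g) (S : orbit_reps h)
    (t : forall x, hom (h x) (g x)) :
  (forall x, g x = h x) -> natural_iso t ->
  graded_isomorphic (orbit_cat R) (orbit_cat S).
Proof.
move=> gh t_nat; have [r r_pow] := power_family_exists t_nat.
have orbitE x : orbit_of g x = orbit_of h x.
  by apply/seteqP; split=> y [n ->]; exists n; rewrite ipow_eq.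
have cP (O : orb g) : exists x, sval O = orbit_of h x.
  by have [x Ox] := svalP O; exists x; rewrite Ox orbitE.
have c'P (O : orb h) : exists x, sval O = orbit_of g x.
  by have [x Ox] := svalP O; exists x; rewrite Ox orbitE.
pose c (O : orb g) : orb h := exist _ (sval O) (cP O).
pose c' (O : orb h) : orb g := exist _ (sval O) (c'P O).
have cK : cancel c c' by case=> O H; exact: eq_exist.
have c'K : cancel c' c by case=> O H; exact: eq_exist.
have /choice[a aP] (O : orb g) : exists n : int, S (c O) = ipow h n (R O).
  have := repP S (c O); have := repP R O; rewrite /= => RO SO.
  have [x Ox] := cP O; rewrite Ox in RO SO; case: RO SO => n -> [m ->].
  by exists (m - n); rewrite ipowD subrK.
pose s O := sval (cid (orbit_shift_exists (aP O))).
have sP O : orbit_shift (a O) (s O) := svalP (cid (orbit_shift_exists (aP O))).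
have aP' O : R O = ipow h (- a O) (S (c O)) by rewrite aP ipowD addNr.
pose s' O := sval (cid (orbit_shift_exists (aP' O))).
have s'P O : orbit_shift (- a O) (s' O) := svalP (cid (orbit_shift_exists (aP' O))).
have s's O := (orbit_shift_inverse (sP O) (s'P O)).1.
have ss' O := (orbit_shift_inverse (sP O) (s'P O)).2.
pose H (X Y : ocat R) (f : hom X Y) : @hom k (ocat S) (c X) (c Y) :=
  ocomp (s Y) (ocomp (otwist r f) (s' X)).
have H_lin X Y : linear (H X Y).
  move=> b u v; rewrite /H (otwist_linear r) (ocomp_linl (s' X)).
  exact: (ocomp_linr (s Y)).
pose HL X Y : {linear @hom k (ocat R) X Y -> @hom k (ocat S) (c X) (c Y)} :=
  HB.pack (H X Y) (GRing.isLinear.Build k _ _ _ (H X Y) (H_lin X Y)).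
have H1 X : HL X X (idm X) = @idm k (ocat S) (c X).
  by rewrite /= /H (otwist_id r_pow) ocomp1m.
have HM X Y Z (q : @hom k (ocat R) Y Z) (f : @hom k (ocat R) X Y) :
    HL X Z (comp q f) = comp (HL Y Z q) (HL X Y f).
  rewrite /= /H (otwist_comp t_nat r_pow) -!ocompA; congr ocomp; congr ocomp.
  by rewrite !ocompA s's ocomp1m.
pose HF := @Functor k (ocat R) (ocat S) c HL H1 HM.
have bij X Y : bijective (fmap HF X Y).
  have [e eK Ke] := otwist_bijective t_nat r_pow (R X) (R Y).
  exists (fun f => e (ocomp (s' Y) (ocomp f (s X)))) => f /=; rewrite /H.
    by rewrite -!ocompA s's ocompm1 ocompA s's ocomp1m eK.
  by rewrite Ke -!ocompA ss' ocompm1 ocompA ss' ocomp1m.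
have [F FE] := iso_of_bijective (F := HF) cK c'K bij.
exists F, (fun X => - a X) => X Y d f fd; rewrite FE.
rewrite (_ : d + - a X = a Y + ((- a Y + d) + - a X)); last by rewrite !addrA subrr add0r.
apply: (homogeneous_comp (sP Y).1); apply: homogeneous_comp (s'P X).1.
exact: otwist_homogeneous.
Qed.

End OrbitCategories.

(** * Consecutive layers of the repetitive category *)

Section Duality.
Variables (k : fieldType) (V : vectType k).
Implicit Types (b : 'Hom(V, k^o)) (v : V).

Definition dual_coord (i : 'I_(\dim {:V})) : 'Hom(V, k^o) :=
  linfun (coord (vbasis {:V}) i : V -> k^o).

Lemma dual_coordE i v : dual_coord i v = coord (vbasis {:V}) i v.
Proof. exact: lfunE. Qed.

Lemma dual_separates v v' : (forall b, b v = b v') -> v = v'.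
Proof.
move=> e; rewrite (coord_vbasis (memvf v)) (coord_vbasis (memvf v')).
by apply: eq_bigr => i _; rewrite -!dual_coordE e.
Qed.

(** Surjectivity of the map from a finite-dimensional space to its bidual,
for functions l that are not packed as linear maps. *)
Lemma bidual_eval (l : 'Hom(V, k^o) -> k^o) : linear l ->
  exists v, forall b, l b = b v.
Proof.
move=> l_lin; pose lL : {linear 'Hom(V, k^o) -> k^o} :=
  HB.pack l (GRing.isLinear.Build k _ _ _ l l_lin).
exists (\sum_(i < \dim {:V}) l (dual_coord i) *: (vbasis {:V})`_i) => b.
have bE : b = \sum_(i < \dim {:V}) b (vbasis {:V})`_i *: dual_coord i.
  apply/lfunP => v; rewrite sum_lfunE {1}(coord_vbasis (memvf v)) linear_sum.
  apply: eq_bigr => i _; rewrite scale_lfunE dual_coordE linearZ /=.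
  exact: mulrC.
transitivity (lL b) => //; rewrite {1}bE !linear_sum; apply: eq_bigr => i _.
by rewrite !linearZ /=; exact: mulrC.
Qed.

End Duality.

Section Layers.
Variables (k : fieldType) (A : bcalg k).
Implicit Types p q : rcat A.

Lemma rval_same_layer p q (u : hom p q) : q.2 = p.2 -> (rval u).2 = 0.
Proof.
case: u => -[u1 u2] /= /andP[_ /=]; case: eqP => [-> _ e|_ /eqP //].
by exfalso; lia.
Qed.

Lemma rval_next_layer p q (u : hom p q) : q.2 = p.2 + 1 -> (rval u).1 = 0.
Proof.
case: u => -[u1 u2] /= /andP[/=]; case: eqP => [-> _ _ e|_ /eqP //].
by exfalso; lia.
Qed.

Lemma same_layer_hom p q (a : ahom p.1 q.1) : q.2 = p.2 ->
  exists u : hom p q, rval u = (a, 0).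
Proof.
move=> e; have s : @rsupp k A p q (a, 0) by rewrite /rsupp /= e !eqxx orbT.
by exists (RHom s).
Qed.

Lemma next_layer_hom p q : q.2 = p.2 + 1 ->
  exists2 d : adual p.1 q.1 -> hom p q, linear d & forall b, rval (d b) = (0, b).
Proof.
move=> e; have s (b : adual p.1 q.1) : @rsupp k A p q (0, b).
  by rewrite /rsupp /= e !eqxx orbT.
exists (fun b => RHom (s b)) => // a b b'; apply: val_inj => /=.
by rewrite -[in LHS](addr0 0) -{1}(scaler0 _ a).
Qed.

Lemma rval_comp2_right p p' q (b : hom p' q) (f : hom p p') (u : ahom q.1 p.1) :
  p'.2 = p.2 -> (rval (comp b f)).2 u = (rval b).2 (acomp (rval f).1 u).
Proof.
move=> e; rewrite /= add_lfunE dmulrE (rval_same_layer f e) dmull0.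
by rewrite lfunE addr0.
Qed.

Lemma rval_comp2_left p q q' (f : hom q q') (b : hom p q) (u : ahom q'.1 p.1) :
  q'.2 = q.2 -> (rval (comp f b)).2 u = (rval b).2 (acomp u (rval f).1).
Proof.
move=> e; rewrite /= add_lfunE dmullE (rval_same_layer f e) dmul0r.
by rewrite lfunE add0r.
Qed.

Lemma hom_next_layer_eq p q (u v : hom p q) :
  q.2 = p.2 + 1 -> (forall a, (rval u).2 a = (rval v).2 a) -> u = v.
Proof.
move=> e uv; apply: val_inj; rewrite /= (surjective_pairing (rval u)).
rewrite (surjective_pairing (rval v)) !rval_next_layer //; congr pair.
exact/lfunP.
Qed.

Lemma hom_same_layer_eq p q (u v : hom p q) :
  q.2 = p.2 -> (rval u).1 = (rval v).1 -> u = v.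
Proof.
move=> e uv; apply: val_inj; rewrite /= (surjective_pairing (rval u)).
by rewrite (surjective_pairing (rval v)) !rval_same_layer // uv.
Qed.

(** Faithfulness of DA: the arrows from (q'.1, i) to q are the linear forms on
the space containing a and a', and evaluating the composites at an identity
evaluates these forms at a and a'. *)
Lemma comp_from_below_inj i q q' (a a' : hom q q') : q.2 = i + 1 -> q'.2 = i + 1 ->
  (forall p (b : hom p q), p.2 = i -> comp a b = comp a' b) -> a = a'.
Proof.
move=> qi q'i aa'; have e : q'.2 = q.2 by rewrite qi q'i.
apply: hom_same_layer_eq => //; apply: dual_separates => b.
pose p : rcat A := (q'.1, i); have [d _ dE] := @next_layer_hom p q qi.
have : (rval (comp a (d b))).2 (aid q'.1) = (rval (comp a' (d b))).2 (aid q'.1).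
  by rewrite aa'.
by rewrite !rval_comp2_left // dE /= !acomp1m.
Qed.

(** The dual of [comp_from_below_inj]. *)
Lemma comp_to_above_inj i p p' (a a' : hom p p') : p.2 = i -> p'.2 = i ->
  (forall q (b : hom p' q), q.2 = i + 1 -> comp b a = comp b a') -> a = a'.
Proof.
move=> pi p'i aa'; have e : p'.2 = p.2 by rewrite pi p'i.
apply: hom_same_layer_eq => //; apply: dual_separates => b.
pose q : rcat A := (p.1, i + 1); have qi : q.2 = p'.2 + 1 by rewrite p'i.
have [d _ dE] := next_layer_hom qi.
have : (rval (comp (d b) a)).2 (aid p.1) = (rval (comp (d b) a')).2 (aid p.1).
  by rewrite aa'.
by rewrite !rval_comp2_right // dE /= !acompm1.
Qed.

(** The transposes of the maps T p form a natural transformation between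
representable functors on A, so they are composition with the image a of an
identity; a is found as the element of the bidual given by the form l. *)
Lemma postcomp_representable i q q' (T : forall p, hom p q -> hom p q') :
  q.2 = i + 1 -> q'.2 = i + 1 ->
  (forall p, p.2 = i -> linear (T p)) ->
  (forall p p' (b : hom p' q) (f : hom p p'), p.2 = i -> p'.2 = i ->
     T p (comp b f) = comp (T p' b) f) ->
  exists v : hom q q', forall p (b : hom p q), p.2 = i -> T p b = comp v b.
Proof.
move=> qi q'i T_lin T_nat; have e : q'.2 = q.2 by rewrite qi q'i.
pose p0 : rcat A := (q'.1, i).
have [d d_lin dE] := @next_layer_hom p0 q qi.
pose l (b : adual q'.1 q.1) : k^o := (rval (T p0 (d b))).2 (aid q'.1).
have l_lin : linear l.
  by move=> c b b'; rewrite /l d_lin T_lin //= add_lfunE scale_lfunE.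
have [a aE] := bidual_eval l_lin; have [v vE] := @same_layer_hom q q' a e.
exists v => p b pi; apply: hom_next_layer_eq; first by rewrite q'i pi.
move=> u; rewrite rval_comp2_left // vE /=.
have [f fE] := @same_layer_hom p0 p u pi.
have pp0 : p.2 = p0.2 by rewrite pi.
have fb : comp b f = d (dmulr (rval b).2 u).
  apply: hom_next_layer_eq => // w.
  by rewrite rval_comp2_right // dE /= dmulrE fE.
have := rval_comp2_right (T p b) f (aid q'.1) pp0.
rewrite fE acompm1 => <-; rewrite -T_nat // fb.
exact: etrans (aE _) (dmulrE _ _ _).
Qed.

(** The dual of [postcomp_representable], with the functors covariant. *)
Lemma precomp_representable i p p' (T : forall q, hom p q -> hom p' q) :
  p.2 = i -> p'.2 = i ->
  (forall q, q.2 = i + 1 -> linear (T q)) ->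
  (forall q q' (f : hom q q') (b : hom p q), q.2 = i + 1 -> q'.2 = i + 1 ->
     T q' (comp f b) = comp f (T q b)) ->
  exists v : hom p' p, forall q (b : hom p q), q.2 = i + 1 -> T q b = comp b v.
Proof.
move=> pi p'i T_lin T_nat; have e : p.2 = p'.2 by rewrite pi p'i.
pose q0 : rcat A := (p'.1, i + 1).
have q0p : q0.2 = p.2 + 1 by rewrite pi.
have [d d_lin dE] := next_layer_hom q0p.
pose l (b : adual p.1 p'.1) : k^o := (rval (T q0 (d b))).2 (aid p'.1).
have l_lin : linear l.
  by move=> c b b'; rewrite /l d_lin T_lin //= add_lfunE scale_lfunE.
have [a aE] := bidual_eval l_lin; have [v vE] := @same_layer_hom p' p a e.
exists v => q b qi; apply: hom_next_layer_eq; first by rewrite qi p'i.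
move=> u; rewrite rval_comp2_right // vE /=.
have qq0 : q0.2 = q.2 by rewrite qi.
have [f fE] := @same_layer_hom q q0 u qq0.
have fb : comp f b = d (dmull u (rval b).2).
  by apply: hom_next_layer_eq => // w; rewrite rval_comp2_left // dE /= dmullE fE.
have := rval_comp2_left f (T q b) (aid p'.1) qq0.
rewrite fE acomp1m => <-; rewrite -T_nat // fb.
exact: etrans (aE _) (dmullE _ _ _).
Qed.

(** The inverse maps are natural as well, hence also postcomposition with an
arrow, and [comp_from_below_inj] shows that the two arrows are inverse. *)
Lemma postcomp_iso_representable i q q' (T : forall p, hom p q -> hom p q')
    (T' : forall p, hom p q' -> hom p q) :
  q.2 = i + 1 -> q'.2 = i + 1 ->
  (forall p, p.2 = i -> linear (T p)) ->
  (forall p p' (b : hom p' q) (f : hom p p'), p.2 = i -> p'.2 = i ->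
     T p (comp b f) = comp (T p' b) f) ->
  (forall p, p.2 = i -> cancel (T p) (T' p) /\ cancel (T' p) (T p)) ->
  exists2 v : hom q q', invertible v &
    forall p (b : hom p q), p.2 = i -> T p b = comp v b.
Proof.
move=> qi q'i T_lin T_nat TT'.
have [v vT] := postcomp_representable qi q'i T_lin T_nat.
have T'_lin p : p.2 = i -> linear (T' p).
  move=> pi a b b'; have [TK T'K] := TT' p pi.
  by apply: (can_inj TK); rewrite T_lin // !T'K.
have T'_nat p p' (b : hom p' q') (f : hom p p') : p.2 = i -> p'.2 = i ->
    T' p (comp b f) = comp (T' p' b) f.
  move=> pi p'i; have [TK T'K] := TT' p pi; have [_ T'K'] := TT' p' p'i.
  by apply: (can_inj TK); rewrite T_nat // T'K T'K'.
have [w wT] := postcomp_representable q'i qi T'_lin T'_nat.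
exists v => //; exists w; split.
  apply: (comp_from_below_inj qi qi) => p b pi.
  by rewrite comp1m -compA -vT // -wT // (TT' p pi).1.
apply: (comp_from_below_inj q'i q'i) => p b pi.
by rewrite comp1m -compA -wT // -vT // (TT' p pi).2.
Qed.

Lemma precomp_iso_representable i p p' (T : forall q, hom p q -> hom p' q)
    (T' : forall q, hom p' q -> hom p q) :
  p.2 = i -> p'.2 = i ->
  (forall q, q.2 = i + 1 -> linear (T q)) ->
  (forall q q' (f : hom q q') (b : hom p q), q.2 = i + 1 -> q'.2 = i + 1 ->
     T q' (comp f b) = comp f (T q b)) ->
  (forall q, q.2 = i + 1 -> cancel (T q) (T' q) /\ cancel (T' q) (T q)) ->
  exists2 v : hom p' p, invertible v &
    forall q (b : hom p q), q.2 = i + 1 -> T q b = comp b v.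
Proof.
move=> pi p'i T_lin T_nat TT'.
have [v vT] := precomp_representable pi p'i T_lin T_nat.
have T'_lin q : q.2 = i + 1 -> linear (T' q).
  move=> qi a b b'; have [TK T'K] := TT' q qi.
  by apply: (can_inj TK); rewrite T_lin // !T'K.
have T'_nat q q' (f : hom q q') (b : hom p' q) : q.2 = i + 1 -> q'.2 = i + 1 ->
    T' q' (comp f b) = comp f (T' q b).
  move=> qi q'i; have [_ T'K] := TT' q qi; have [TK' T'K'] := TT' q' q'i.
  by apply: (can_inj TK'); rewrite T_nat // T'K T'K'.
have [w wT] := precomp_representable p'i pi T'_lin T'_nat.
exists v => //; exists w; split.
  apply: (comp_to_above_inj p'i p'i) => q b qi.
  by rewrite compm1 compA -wT // -vT // (TT' q qi).2.
apply: (comp_to_above_inj pi pi) => q b qi.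
by rewrite compm1 compA -vT // -wT // (TT' q qi).1.
Qed.

End Layers.

(** * Extending a natural isomorphism from one layer to all layers *)

Section Extension.
Variables (k : fieldType) (A : bcalg k) (psi : iso (rcat A) (rcat A)).
Hypothesis psi_layer : forall p, (psi p).2 = p.2.
Implicit Types (p q : rcat A) (t : forall p, hom p (psi p)).

Definition between (a b : int) p : bool := (a <= p.2) && (p.2 <= b).

Definition natural_between a b t : Prop :=
  (forall p, between a b p -> invertible (t p)) /\
  forall p q (f : hom p q), between a b p -> between a b q ->
    comp (fmap psi _ _ f) (t p) = comp (t q) f.

Lemma psi_precomp_inverse t p q : invertible (t p) ->
  exists T' : hom p (psi q) -> hom p q,
    cancel (fun f => comp (fmap psi _ _ f) (t p)) T' /\
    cancel T' (fun f => comp (fmap psi _ _ f) (t p)).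
Proof.
move=> ti; pose u := sval (cid ti); have [ut tu] := svalP (cid ti).
have ex f := cid (iso_fmap_surj (comp f u : hom (psi p) (psi q))).
have T'K : cancel (fun f => sval (ex f)) (fun f => comp (fmap psi p q f) (t p)).
  by move=> f; rewrite (svalP (ex f)) -compA ut compm1.
exists (fun f => sval (ex f)); split=> // f.
apply: (@iso_fmap_inj _ _ _ psi); apply: (comp_invertibleI ti).
exact: T'K.
Qed.

Lemma psi_postcomp_inverse t p q : invertible (t q) ->
  exists (T : hom p q -> hom (psi p) q) (T' : hom (psi p) q -> hom p q),
    [/\ forall f, comp (t q) (T f) = fmap psi _ _ f, cancel T T' & cancel T' T].
Proof.
move=> ti; pose u := sval (cid ti); have [ut tu] := svalP (cid ti).
pose T f := comp u (fmap psi p q f).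
have TE f : comp (t q) (T f) = fmap psi _ _ f by rewrite compA tu comp1m.
have ex f := cid (iso_fmap_surj (comp (t q) f : hom (psi p) (psi q))).
have T'K : cancel (fun f => sval (ex f)) T.
  by move=> f; rewrite /T (svalP (ex f)) compA ut comp1m.
exists T, (fun f => sval (ex f)); split=> // f.
apply: (@iso_fmap_inj _ _ _ psi).
by rewrite -TE -[RHS]TE T'K.
Qed.

(** The new components are those that represent b |-> psi b o t_p. *)
Lemma extend_up a b t : (a <= b) -> natural_between a b t ->
  exists t', natural_between a (b + 1) t' /\ forall p, p.2 <= b -> t' p = t p.
Proof.
move=> ab [t_inv t_nat].
have lay p : p.2 = b -> between a b p by move=> e; rewrite /between e; lia.
have ex q : {v : hom q (psi q) | q.2 = b + 1 -> invertible v /\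
    forall p (f : hom p q), p.2 = b -> comp (fmap psi _ _ f) (t p) = comp v f}.
  apply: cid; have [qb|] := pselect (q.2 = b + 1); last by exists 0.
  pose T p (f : hom p q) := comp (fmap psi _ _ f) (t p).
  have T'_ex p : {T' : hom p (psi q) -> hom p q |
      p.2 = b -> cancel (T p) T' /\ cancel T' (T p)}.
    apply: cid; have [pb|] := pselect (p.2 = b); last by exists (fun=> 0).
    by have [T' T'P] := psi_precomp_inverse q (t_inv p (lay p pb)); exists T'.
  have qb' : (psi q).2 = b + 1 by rewrite psi_layer.
  have T_lin p : p.2 = b -> linear (T p).
    by move=> _ c f f'; rewrite /T linearP; exact: (comp_linl (t p)).
  have T_nat p p' (f : hom p' q) (f' : hom p p') : p.2 = b -> p'.2 = b ->
      T p (comp f f') = comp (T p' f) f'.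
    by move=> pb pb'; rewrite /T fmapM -compA t_nat ?compA //; apply: lay.
  have [v vi vT] := postcomp_iso_representable qb qb' T_lin T_nat
    (fun p => svalP (T'_ex p)).
  by exists v.
pose t' q := if q.2 == b + 1 then sval (ex q) else t q.
have t'up q : q.2 = b + 1 -> t' q = sval (ex q) by rewrite /t' => /eqP ->.
have t'dn q : q.2 <= b -> t' q = t q.
  by rewrite /t'; case: eqP => // ? ?; exfalso; lia.
exists t'; split; last exact: t'dn.
have bup p : between a (b + 1) p -> p.2 = b + 1 \/ between a b p.
  by rewrite /between; lia.
have t'up_nat p q (f : hom p q) : p.2 = b -> q.2 = b + 1 ->
    comp (fmap psi _ _ f) (t' p) = comp (t' q) f.
  by move=> pb qb; rewrite t'dn ?pb // t'up //; exact: (svalP (ex q) qb).2.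
split=> [p /bup[pb|pb]|p q f].
- by rewrite t'up //; exact: (svalP (ex p) pb).1.
- by rewrite t'dn; [exact: t_inv | case/andP: pb].
have [->|f0] := eqVneq f 0; first by rewrite linear0 comp0l comp0r.
have fpq := rhom_neq0 f0.
(* A nonzero arrow keeps the layer or raises it by 1. *)
move=> /bup[pb|pb] /bup[qb|qb].
- apply: (comp_from_below_inj pb) => [|r g rb]; first by rewrite psi_layer.
  rewrite -!compA -t'up_nat // -t'up_nat // compA -fmapM.
  by [].
- by exfalso; move: qb; rewrite /between; case: fpq => ->; lia.
- have pb' : p.2 = b by move: pb; rewrite /between; case: fpq; lia.
  exact: t'up_nat.
by rewrite !t'dn ?t_nat //; [case/andP: qb | case/andP: pb].
Qed.

(** The maps b |-> t_q^-1 o psi b, for q in layer a, are represented by the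
inverse of the new component. *)
Lemma extend_down a b t : (a <= b) -> natural_between a b t ->
  exists t', natural_between (a - 1) b t' /\ forall p, a <= p.2 -> t' p = t p.
Proof.
move=> ab [t_inv t_nat].
have lay p : p.2 = a -> between a b p by move=> e; rewrite /between e; lia.
have ex p : {v : hom p (psi p) | p.2 = a - 1 -> invertible v /\
    forall q (f : hom p q), q.2 = a -> comp (fmap psi _ _ f) v = comp (t q) f}.
  apply: cid; have [pa|] := pselect (p.2 = a - 1); last by exists 0.
  have T_ex q : {T : (hom p q -> hom (psi p) q) * (hom (psi p) q -> hom p q) |
      q.2 = a - 1 + 1 -> [/\ forall f, comp (t q) (T.1 f) = fmap psi _ _ f,
                      cancel T.1 T.2 & cancel T.2 T.1]}.
    rewrite subrK; apply: cid; have [qa|] := pselect (q.2 = a); last first.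
      by exists (fun=> 0, fun=> 0).
    have [T [T' TP]] := psi_postcomp_inverse p (t_inv q (lay q qa)).
    by exists (T, T').
  pose T q := (sval (T_ex q)).1; pose T' q := (sval (T_ex q)).2.
  have TP q : q.2 = a - 1 + 1 -> [/\ forall f, comp (t q) (T q f) = fmap psi _ _ f,
      cancel (T q) (T' q) & cancel (T' q) (T q)].
    exact: svalP (T_ex q).
  have lay' q : q.2 = a - 1 + 1 -> between a b q by rewrite subrK; exact: lay.
  have T_lin q : q.2 = a - 1 + 1 -> linear (T q).
    move=> qa c f f'; have [TE _ _] := TP q qa.
    apply: (comp_invertibleK (t_inv q (lay' q qa))).
    by rewrite TE linearP -!TE (comp_linr (t q)).
  have T_nat q q' (f : hom q q') (f' : hom p q) : q.2 = a - 1 + 1 ->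
      q'.2 = a - 1 + 1 -> T q' (comp f f') = comp f (T q f').
    move=> qa qa'; have [TE _ _] := TP q qa; have [TE' _ _] := TP q' qa'.
    apply: (comp_invertibleK (t_inv q' (lay' q' qa'))).
    by rewrite TE' fmapM -TE !compA t_nat //; exact: lay'.
  have pa' : (psi p).2 = a - 1 by rewrite psi_layer.
  have T'T q : q.2 = a - 1 + 1 -> cancel (T q) (T' q) /\ cancel (T' q) (T q).
    by move=> /TP[].
  have [v [w [vw wv]] vT] := precomp_iso_representable pa pa' T_lin T_nat T'T.
  exists w => _; split; first by exists v.
  move=> q f qa; have qa' : q.2 = a - 1 + 1 by rewrite qa subrK.
  have [TE _ _] := TP q qa'.
  by rewrite -TE vT // -!compA wv compm1.
pose t' p := if p.2 == a - 1 then sval (ex p) else t p.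
have t'dn p : p.2 = a - 1 -> t' p = sval (ex p) by rewrite /t' => /eqP ->.
have t'up p : a <= p.2 -> t' p = t p.
  by rewrite /t'; case: eqP => // ? ?; exfalso; lia.
exists t'; split; last exact: t'up.
have bdn p : between (a - 1) b p -> p.2 = a - 1 \/ between a b p.
  by rewrite /between; lia.
have t'dn_nat p q (f : hom p q) : p.2 = a - 1 -> q.2 = a ->
    comp (fmap psi _ _ f) (t' p) = comp (t' q) f.
  by move=> pa qa; rewrite t'dn // t'up ?qa //; exact: (svalP (ex p) pa).2.
split=> [p /bdn[pa|pa]|p q f].
- by rewrite t'dn //; exact: (svalP (ex p) pa).1.
- by rewrite t'up; [exact: t_inv | case/andP: pa].
have [->|f0] := eqVneq f 0; first by rewrite linear0 comp0l comp0r.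
have fpq := rhom_neq0 f0.
move=> /bdn[pa|pa] /bdn[qa|qa].
- have qa' : (psi q).2 = a - 1 by rewrite psi_layer.
  (* By fullness of psi, the images psi g detect arrows as all arrows do. *)
  have inj (u v : hom p (psi q)) : (forall r (g : hom q r), r.2 = a ->
      comp (fmap psi _ _ g) u = comp (fmap psi _ _ g) v) -> u = v.
    move=> uv; apply: (comp_to_above_inj pa qa') => r g; rewrite subrK => ra.
    have [g' g'E] := arr_ex g erefl (esym (isoinvK_obj psi r)).
    have [g0 g0E] := iso_fmap_surj g'.
    apply: arr_inj; transitivity (arr (comp g' u)); first exact: arr_comp.
    transitivity (arr (comp g' v)); last exact: arr_comp.
    by congr arr; rewrite -g0E uv // -psi_layer isoinvK_obj.
  apply: inj => r g ra; rewrite !compA -fmapM.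
  by rewrite t'dn_nat // t'dn_nat // compA.
- have qa' : q.2 = a by move: qa; rewrite /between; case: fpq => ->; lia.
  exact: t'dn_nat.
- by exfalso; move: pa; rewrite /between; case: fpq; lia.
by rewrite !t'up ?t_nat //; [case/andP: qa | case/andP: pa].
Qed.

(** Alternate the two extensions and take the limit: the component at p does
not change once the window of layers around m has reached p. *)
Lemma extend_everywhere m t : natural_between m m t ->
  exists t', natural_iso (F := fid (rcat A)) (G := psi) t'.
Proof.
move=> t_m.
have step (j : nat) t0 : natural_between (m - j%:Z) (m + j%:Z) t0 ->
    {t1 | natural_between (m - j.+1%:Z) (m + j.+1%:Z) t1 /\
      forall p, between (m - j%:Z) (m + j%:Z) p -> t1 p = t0 p}.
  move=> t0P; apply: cid.
  have [|t1 [t1P t10]] := extend_up _ t0P; first by lia.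
  have [|t2 [t2P t21]] := extend_down _ t1P; first by lia.
  exists t2; rewrite (_ : m - j.+1%:Z = m - j%:Z - 1); last by lia.
  rewrite (_ : m + j.+1%:Z = m + j%:Z + 1); last by lia.
  by split=> // p /andP[pa pb]; rewrite t21 // t10.
have base : natural_between (m - 0%:Z) (m + 0%:Z) t by rewrite subr0 ?addr0.
pose W (j : nat) := {t | natural_between (m - j%:Z) (m + j%:Z) t}.
pose s := fix s (j : nat) : W j := match j return W j with
  | 0%N => exist _ t base
  | j'.+1 => let w := step j' (sval (s j')) (svalP (s j')) in
             exist _ (sval w) (svalP w).1
  end.
have sE (j : nat) p : between (m - j%:Z) (m + j%:Z) p ->
    sval (s j.+1) p = sval (s j) p.
  exact: (svalP (step j (sval (s j)) (svalP (s j)))).2.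
have s_stable (i j : nat) p : (i <= j)%N -> between (m - i%:Z) (m + i%:Z) p ->
    sval (s j) p = sval (s i) p.
  move=> ij pi; rewrite -(subnK ij); elim: (j - i)%N => [//|d IH].
  by rewrite addSn sE //; move: pi; rewrite /between; lia.
pose t' p := sval (s (absz (p.2 - m))) p.
have bt p : between (m - (absz (p.2 - m))%:Z) (m + (absz (p.2 - m))%:Z) p.
  by rewrite /between; lia.
have t'E j p : between (m - j%:Z) (m + j%:Z) p -> t' p = sval (s j) p.
  by move=> pj; rewrite (@s_stable (absz (p.2 - m)) j) //; move: pj; rewrite /between; lia.
exists t'; split=> [p|p q f]; first exact: ((svalP (s _)).1 _ (bt p)).
pose j := maxn (absz (p.2 - m)) (absz (q.2 - m)).
have pj : between (m - j%:Z) (m + j%:Z) p by rewrite /between /j; lia.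
have qj : between (m - j%:Z) (m + j%:Z) q by rewrite /between /j; lia.
by rewrite (t'E j p) // (t'E j q) //; exact: (svalP (s j)).2.
Qed.

End Extension.

(** * Automorphisms with a jump and their twists *)

Section Agreement.
Variables (k : fieldType) (A : bcalg k).

(** Multiplication by v and its inverse identifies the left ideals A e_x and
A e_y, so this is basicness of A. *)
Lemma isomorphic_vertices_eq (x y : acat A) (v : hom x y) : invertible v -> x = y.
Proof.
move=> [w [wv vw]]; apply: contrapT => /eqP xy; apply: (basicP xy).
have {}wv : val (w : ahom y x) * val (v : ahom x y) = idem x := congr1 val wv.
have {}vw : val (v : ahom x y) * val (w : ahom y x) = idem y := congr1 val vw.
have /peirceP[_ wy] := subvsP (w : ahom y x).
have /peirceP[_ vx] := subvsP (v : ahom x y).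
have mulE (a u : A) : amulr a u = u * a by rewrite lfunE.
exists (amulr (val (w : ahom y x))); split.
- by move=> a u _; rewrite !mulE mulrA.
- move=> _ _ /memv_imgP[a _ ->] /memv_imgP[b _ ->]; rewrite !mulE.
  move=> /(congr1 (fun u => u * val (v : ahom x y))).
  by rewrite -!mulrA wv !idem_idem.
apply/eqP; rewrite eqEsubv; apply/andP; split; apply/subvP => u.
  move=> /memv_imgP[_ /memv_imgP[a _ ->] ->]; apply/memv_imgP.
  by exists (a * idem x * val (w : ahom y x)); rewrite ?memvf // !mulE -!mulrA wy.
move=> /memv_imgP[a _ ->]; rewrite mulE -vw mulrA -mulE; apply: memv_img.
by apply/memv_imgP; exists (a * val (v : ahom x y)); rewrite ?memvf // mulE -mulrA vx.
Qed.

Lemma isomorphic_objects_eq (p q : rcat A) (v : hom p q) :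
  invertible v -> p.2 = q.2 -> p = q.
Proof.
move=> /(invertible_fmap (rproj A)) /isomorphic_vertices_eq.
by case: p q {v} => x i [y j] /= -> ->.
Qed.

Lemma natural_between_of_fixed (psi : iso (rcat A) (rcat A)) m :
  (forall p q (u : @hom k (rcat A) p q), p.2 = m -> q.2 = m ->
     amap psi (arr u) = arr u) ->
  exists t : forall p, hom p (psi p), natural_between m m t.
Proof.
move=> fixed; pose t (p : rcat A) : hom p (psi p) :=
  if pselect (psi p = p) is left e then cast_src e (idm (psi p)) else 0.
have tE (p : rcat A) : p.2 = m -> psi p = p /\ arr (t p) = arr (idm p).
  move=> pm; have e : psi p = p.
    exact: (congr1 (fun u : arrow (rcat A) => (projT1 u).1) (fixed _ _ (idm p) pm pm)).
  by split=> //; rewrite /t; case: pselect => // e'; rewrite arr_cast; apply: arr_idm.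
have lay (p : rcat A) : between m m p -> p.2 = m by rewrite /between; lia.
exists t; split=> [p /lay/tE[_ e]|p q f /lay pm /lay qm].
  exact: invertible_arr (esym e) (invertible_idm p).
have [pe tp] := tE p pm; have [qe tq] := tE q qm.
apply: arr_inj; transitivity (arr (comp f (idm p))).
  by apply: arr_comp => //; rewrite -(fixed _ _ f pm qm).
rewrite compm1 -[f in LHS]comp1m; exact: arr_comp.
Qed.

Variables (phi : iso (rcat A) (rcat A)) (n : int) (hn : has_jump phi n).

Let phi' := twist n (phi0 hn).

Lemma twist_layer p : (phi' p).2 = p.2 + n.
Proof. by rewrite /phi' /= ipow_nakayama. Qed.

Lemma hat_rincl (s : iso (acat A) (acat A)) i (x y : acat A) (f : hom x y) :
  fmap (hat s) _ _ (fmap (rincl A i) x y f) = fmap (rincl A i) _ _ (fmap s _ _ f).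
Proof. by apply: val_inj; rewrite /= /hat_val /= comp_lfun0l. Qed.

(** An arrow u of layer -n comes from an arrow f of A, and phi0 f is by
definition the arrow of A underlying phi u, which lies in layer 0. *)
Lemma twist_agree p q (u : @hom k (rcat A) p q) : p.2 = - n -> q.2 = - n ->
  amap phi' (arr u) = amap phi (arr u).
Proof.
move=> pn qn; pose N := ipow (nakayama A) n; pose N' := ipow (nakayama A) (- n).
pose v := fmap N _ _ u; pose f := fmap (rproj A) _ _ v.
have vE : arr (fmap (rincl A 0) _ _ f) = arr v.
  by apply: rprojK; rewrite ipow_nakayama /= ?pn ?qn addNr.
have uE : amap N' (arr v) = arr u.
  by rewrite /v -(amap_arr N) -amap_ipowD addNr.
transitivity (amap (hat (phi0 hn)) (arr v)) => //.
rewrite -vE amap_arr hat_rincl.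
rewrite -uE -vE.
by apply: rprojK; rewrite (jump_index _ hn) ipow_nakayama /= ipow_nakayama /= add0r addNr.
Qed.

(** With psi = phi'^-1 phi, a natural isomorphism t : id -> psi gives
phi'(t) : phi' -> phi, up to the equality phi' (psi p) = phi p. *)
Lemma twist_natural_iso : (forall p, phi p = phi' p) /\
  exists t : forall p, hom (phi' p) (phi p), natural_iso t.
Proof.
pose psi := icomp (iinv phi') phi.
have psiK p : phi' (psi p) = phi p by exact: isoinvK_obj.
have psi_layer p : (psi p).2 = p.2.
  by apply: (addIr n); rewrite -twist_layer psiK (jump_index _ hn).
have [t0 t0P] : exists t : forall p, hom p (psi p), natural_between (- n) (- n) t.
  apply: natural_between_of_fixed => p q u pn qn.
  transitivity (amap (isoinv phi') (amap phi (arr u))) => //.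
  by rewrite -twist_agree // amapK.
have [t [t_inv t_nat]] := extend_everywhere psi_layer t0P.
split=> [p|].
  by rewrite -psiK; congr (phi' _); apply: esym; apply: isomorphic_objects_eq (t_inv p) _.
have ex p := cid (arr_ex (fmap phi' _ _ (t p)) erefl (psiK p)).
exists (fun p => sval (ex p)); split=> [p|p q f].
  apply: (invertible_arr (esym (svalP (ex p)))); exact: invertible_fmap (t_inv p).
apply: arr_inj.
transitivity (arr (comp (fmap phi' _ _ (fmap psi _ _ f)) (fmap phi' _ _ (t p)))).
  by apply: arr_comp; [rewrite isoinvK | exact: (svalP (ex p))].
rewrite -fmapM t_nat fmapM; apply: arr_comp => //; exact: esym (svalP (ex q)).
Qed.

End Agreement.

Theorem corollary5p3 (k : closedFieldType) (A : bcalg k)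
    (phi : iso (rcat A) (rcat A)) (n : int)
    (A_ph : piecewise_hereditary A) (n_neq0 : n <> 0)
    (phi_jump : has_jump phi n)
    (R : orbit_reps phi) (S : orbit_reps (twist n (phi0 phi_jump))) :
  graded_isomorphic (orbit_cat R) (twisted_ext S).
Proof.
have [phiE [t t_nat]] := twist_natural_iso phi_jump.
exact: orbit_cat_isomorphic phiE t_nat.
Qed.
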